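(* Let $\varphi(s)=c_0s+\sum_{k=1}^{+\infty}c_kk^{-s}\in\mathcal G_{>0}$ and let $u$ be its K\''onigs map. Let $\sigma_p(\mathcal C_\varphi)$ denote the set of eigenvalues of $\mathcal C_\varphi:f\mapsto f\circ\varphi$ acting on $\mathcal H^\infty_+$. (i) If $c_0>1$, then $\sigma_p(\mathcal C_\varphi)=\{1\}$. Moreover, for any $f\in\mathcal H^\infty_+$, $f\circ\varphi=f$ if and only if $f$ is constant. (ii) If $c_0=1$ and $\varphi$ is not of the form $\varphi(s)=s+i\tau$ with $\tau\in\mathbb R$, then $\sigma_p(\mathcal C_\varphi)=\{m^{-c_1}:m\in\mathbb N\}$. Moreover, for each $m\in\mathbb N$, $\ker(\mathcal C_\varphi-m^{-c_1})$ has dimension $1$ and is equal to $\mathrm{span}(m^{-u})$. (iii) If $\varphi(s)=s+i\tau$ with $\tau\in\mathbb R\setminus\{0\}$, then $\sigma_p(\mathcal C_\varphi)=\{m^{-i\tau}:m\in\mathbb N\}$. Moreover: (a) if $\tau=2k\pi/\log(m_0/n_0)$ with $k\in\mathbb Z\setminus\{0\}$ and $m_0,n_0\in\mathbb N$, $m_0\neq n_0$, then for all $m\in\mathbb N$, $\ker(\mathcal C_\varphi-m^{-i\tau})$ is spanned (as a closed subspace of $\mathcal H^\infty_+$) by $\{n^{-s}: n\in\mathbb N\text{ and } n=m(n_0/m_0)^{\ell/k}\text{ for some }\ell\in\mathbb Z\}$; (b) if $\tau$ cannot be written $2k\pi/\log(m_0/n_0)$ with $k\in\mathbb Z\setminus\{0\}$,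 $m_0,n_0\ge1$ integers, $m_0\ne n_0$, then for all $m\in\mathbb N$, $\ker(\mathcal C_\varphi-m^{-i\tau})$ has dimension $1$ and is equal to $\mathrm{span}(m^{-s})$.
   Context: $\mathbb N=\{1,2,\dots\}$; for $\theta\in\mathbb R$, $\mathbb C_\theta=\{s:\mathrm{Re}\,s>\theta\}$. $\mathcal G_{>0}$ is the set of maps $\varphi(s)=c_0s+\psi(s)$ where $c_0\ge1$ is an integer (the characteristic), $\psi$ is a Dirichlet series $\sum_{k\ge1}c_kk^{-s}$ converging uniformly in $\mathbb C_\varepsilon$ for every $\varepsilon>0$, and either $\psi\equiv i\tau$ for some $\tau\in\mathbb R$ or $\psi(\mathbb C_0)\subset\mathbb C_0$; such $\varphi$ is a self-map of $\mathbb C_0$. $\mathcal{GH}_{>0}$ is the set of holomorphic $u:\mathbb C_0\to\mathbb C$ of the form $u(s)=d_0s+\theta(s)$ with $d_0$ a positive integer (the characteristic) and $\theta$ a Dirichlet series converging uniformly on each $\mathbb C_\varepsilon$, $\varepsilon>0$. The K\''onigs map of $\varphi$ is a map $u\in\mathcal{GH}_{>0}$ with characteristic $1$ such that $u\circ\varphi=u+c_1$ if $c_0=1$ and $u\circ\varphi=c_0u$ if $c_0>1$; it always exists, and when $c_0=1$ and $\varphi$ is not a vertical translation it is unique up to an additive constant. $\mathcal H^\infty_+$ is the Fr\'echet space of analytic functions on $\mathbb C_0$ that are bounded on $\mathbb C_\varepsilon$ for all $\varepsilon>0$ and can be represented as a convergent Dirichlet series in $\mathbb C_0$, with seminorms $P_\varepsilon(f)=\sup_{\mathbb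 C_\varepsilon}|f|$. *)

(* Defs.v *)
From Stdlib Require Import Reals List.
From Coquelicot Require Import Coquelicot.

Open Scope R_scope.
Open Scope C_scope.

(* Functions on the open right half-plane are represented by total functions
   [C -> C] whose values outside [half_plane 0] carry no information: every
   notion below depends only on the restriction to [half_plane 0], and equality
   of functions is [eq_C0]. *)

Definition half_plane (t : R) (s : C) : Prop := (t < Re s)%R.

Definition eq_C0 (f g : C -> C) : Prop :=
  forall s : C, half_plane 0 s -> f s = g s.

Definition Cexp (z : C) : C :=
  ((exp (Re z) * cos (Im z))%R, (exp (Re z) * sin (Im z))%R).

(* [npow n z] is n^z for an integer n >= 1 (a junk value for n = 0). *)
Definition npow (n : nat) (z : C) : C := Cexp (RtoC (ln (INR n)) * z).

(* The coefficients of a Dirichlet series are indexed from 1: the value of the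
   coefficient sequence at 0 is never used. *)
Definition dirichlet_partial (c : nat -> C) (N : nat) (s : C) : C :=
  sum_n_m (fun k => c k * npow k (- s)) 1 N.

Definition dirichlet_cv (c : nat -> C) (f : C -> C) : Prop :=
  forall s : C, half_plane 0 s ->
    filterlim (fun N => dirichlet_partial c N s) eventually (locally (f s)).

Definition dirichlet_unif_cv (c : nat -> C) (f : C -> C) : Prop :=
  forall eps : R, (0 < eps)%R ->
  forall delta : R, (0 < delta)%R ->
  exists N0 : nat, forall N : nat, (N0 <= N)%nat ->
  forall s : C, half_plane eps s ->
    (Cmod (dirichlet_partial c N s - f s) < delta)%R.

Definition holomorphic_C0 (f : C -> C) : Prop :=
  forall s : C, half_plane 0 s ->
    @ex_derive C_AbsRing C_NormedModule f s.

(* phi belongs to G_{>0}, with characteristic c0 and Dirichlet coefficients c. *)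
Definition G_pos (c0 : nat) (c : nat -> C) (phi : C -> C) : Prop :=
  (1 <= c0)%nat /\
  exists psi : C -> C,
    eq_C0 phi (fun s => RtoC (INR c0) * s + psi s) /\
    dirichlet_unif_cv c psi /\
    ((exists tau : R, eq_C0 psi (fun _ => Ci * RtoC tau)) \/
     (forall s : C, half_plane 0 s -> half_plane 0 (psi s))).

Definition GH_pos (d0 : nat) (u : C -> C) : Prop :=
  (1 <= d0)%nat /\
  holomorphic_C0 u /\
  exists (d : nat -> C) (theta : C -> C),
    eq_C0 u (fun s => RtoC (INR d0) * s + theta s) /\
    dirichlet_unif_cv d theta.

Definition koenigs_map (c0 : nat) (c : nat -> C) (phi u : C -> C) : Prop :=
  GH_pos 1 u /\
  (c0 = 1%nat -> eq_C0 (fun s => u (phi s)) (fun s => u s + c 1%nat)) /\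
  ((1 < c0)%nat -> eq_C0 (fun s => u (phi s)) (fun s => RtoC (INR c0) * u s)).

Definition Hinf_plus (f : C -> C) : Prop :=
  holomorphic_C0 f /\
  (forall eps : R, (0 < eps)%R ->
     exists M : R, forall s : C, half_plane eps s -> (Cmod (f s) <= M)%R) /\
  exists a : nat -> C, dirichlet_cv a f.

Definition seminorm (eps : R) (f : C -> C) : Rbar :=
  Lub_Rbar (fun x : R => exists s : C, half_plane eps s /\ x = Cmod (f s)).

Definition comp_op (phi f : C -> C) : C -> C := fun s => f (phi s).

(* Kernel of [comp_op phi - lambda] on [Hinf_plus]. *)
Definition eigenspace (phi : C -> C) (lambda : C) (f : C -> C) : Prop :=
  Hinf_plus f /\ eq_C0 (comp_op phi f) (fun s => lambda * f s).

Definition point_spectrum (phi : C -> C) (lambda : C) : Prop :=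
  exists f : C -> C,
    eigenspace phi lambda f /\ ~ eq_C0 f (fun _ => RtoC 0).

Definition lin_comb (n : nat) (a : nat -> C) (e : nat -> C -> C) : C -> C :=
  fun s => sum_n_m (fun i => a i * e i s) 1 n.

Definition span (A : (C -> C) -> Prop) (f : C -> C) : Prop :=
  exists (n : nat) (a : nat -> C) (e : nat -> C -> C),
    (forall i : nat, (1 <= i <= n)%nat -> A (e i)) /\
    eq_C0 f (lin_comb n a e).

(* Closure of the span in [Hinf_plus] for the topology of the seminorms: a
   basic neighbourhood of f is given by finitely many of them and a radius. *)
Definition closed_span (A : (C -> C) -> Prop) (f : C -> C) : Prop :=
  Hinf_plus f /\
  forall (l : list R) (delta : R),
    (forall eps : R, In eps l -> (0 < eps)%R) -> (0 < delta)%R ->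
    exists g : C -> C, span A g /\ Hinf_plus g /\
      forall eps : R, In eps l ->
        Rbar_lt (seminorm eps (fun s => f s - g s)) delta.

Definition has_dimension (V : (C -> C) -> Prop) (n : nat) : Prop :=
  exists e : nat -> C -> C,
    (forall a : nat -> C, eq_C0 (lin_comb n a e) (fun _ => RtoC 0) ->
       forall i : nat, (1 <= i <= n)%nat -> a i = RtoC 0) /\
    (forall f : C -> C,
       V f <-> span (fun g => exists i : nat, (1 <= i <= n)%nat /\ g = e i) f).

Definition log_ratio_form (tau : R) (k : Z) (m0 n0 : nat) : Prop :=
  k <> 0%Z /\ (1 <= m0)%nat /\ (1 <= n0)%nat /\ m0 <> n0 /\
  tau = (2 * IZR k * PI / ln (INR m0 / INR n0))%R.

(* Main.v *)
Require Import Defs.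
From Stdlib Require Import Reals Lra Lia List ClassicalEpsilon.
From Coquelicot Require Import Coquelicot.

(** The eigenvalues are read off the leading terms of Dirichlet series. If the
    first nonzero coefficient of f has index m, then f(s) behaves like
    a_m m^(-s) as Re s tends to infinity ([dirichlet_leading_limit]), and the
    equation f(phi(s)) = lambda f(s) compares m^(-phi(s)) with lambda m^(-s)
    ([eigen_leading]). When c0 > 1 this is possible only for m = 1 and
    lambda = 1, and subtracting a_1 shows that f is constant. When c0 = 1 it
    gives lambda = m^(-c_1). If moreover phi is not a vertical translation, then
    Re c_1 > 0 ([Re_first_coef_pos]), so that lambda determines m; two
    eigenvectors for the same lambda are then proportional, because a
    combination that cancels the m-th coefficient has no possible leading index.

    It remains to see that m^(-u) is an eigenvector. The functional equation of
    the Koenigs map gives the eigenvalue equation; the substantial point is that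
    m^(-u) is again the sum of a convergent Dirichlet series. It is a limit of
    Dirichlet polynomials, uniform on every half-plane Re s > eps, so this is a
    case of Bohr's theorem ([bohr_completeness]), and it rests on the estimate
    that truncating a Dirichlet polynomial at N multiplies its supremum on a
    vertical line by at most O(log N) ([truncation_log_bound]). To prove the
    estimate, note that multiplying the coefficients a_n by a triangle function
    of ln n does not increase the supremum, since a triangle is the Fourier
    transform of a positive measure. This follows from the fact that the
    integral of (1 - cos (x t)) / t^2 over t > 0 is a multiple of |x|, by taking
    second differences in x ([second_diff_expsum_bound]). The sharp cut-off at
    ln N is a trapezoid minus O(log N) triangles of half-widths 1/2, 1/4, and so
    on down to about 1/N.

    For a translation by i tau the n-th coefficient is multiplied by
    n^(-i tau), so an eigenspace consists of the series supported on a class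
    of integers n on which n^(-i tau) is constant. Such a class reduces to one
    integer unless tau = 2 k pi / log (m0/n0); in general its elements are
    separated by a fixed ratio, so that the series supported on it converge
    absolutely, uniformly on half-planes ([lacunary_uniform]), and are limits of
    their partial sums. *)

Open Scope R_scope.
Open Scope C_scope.

(** * Finite sums and limits of complex numbers *)

Definition csum (f : nat -> C) (N : nat) : C := sum_n_m f 1 N.

Lemma csum_0 (f : nat -> C) : csum f 0 = 0.
Proof. unfold csum. rewrite sum_n_m_zero; [reflexivity | lia]. Qed.

Lemma csum_S (f : nat -> C) N : csum f (S N) = csum f N + f (S N).
Proof. unfold csum. rewrite sum_n_Sm; [reflexivity | lia]. Qed.

Lemma csum_ext (f g : nat -> C) N :
  (forall n, (1 <= n <= N)%nat -> f n = g n) -> csum f N = csum g N.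
Proof.
  induction N as [|N IH]; intros H.
  - now rewrite !csum_0.
  - rewrite !csum_S, IH, H; auto; try lia. intros; apply H; lia.
Qed.

Lemma csum_plus (f g : nat -> C) N :
  csum (fun n => f n + g n)%C N = csum f N + csum g N.
Proof.
  induction N as [|N IH].
  - rewrite !csum_0. ring.
  - rewrite !csum_S, IH. ring.
Qed.

Lemma csum_scal (k : C) (f : nat -> C) N :
  csum (fun n => k * f n)%C N = k * csum f N.
Proof.
  induction N as [|N IH].
  - rewrite !csum_0. ring.
  - rewrite !csum_S, IH. ring.
Qed.

Lemma csum_minus (f g : nat -> C) N :
  csum (fun n => f n - g n)%C N = csum f N - csum g N.
Proof.
  induction N as [|N IH].
  - rewrite !csum_0. ring.
  - rewrite !csum_S, IH. ring.
Qed.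

Lemma csum_zero (f : nat -> C) N :
  (forall n, (1 <= n <= N)%nat -> f n = 0) -> csum f N = 0.
Proof.
  induction N as [|N IH]; intros H.
  - apply csum_0.
  - rewrite csum_S, IH, H; try lia. ring. intros; apply H; lia.
Qed.

Lemma csum_trunc (f : nat -> C) N K : (N <= K)%nat ->
  (forall n, (N < n <= K)%nat -> f n = 0) -> csum f K = csum f N.
Proof.
  intros HK. induction HK as [|K HK IH]; intros H.
  - reflexivity.
  - rewrite csum_S, IH, H; try lia. ring. intros; apply H; lia.
Qed.

Lemma csum_single (f : nat -> C) m N : (1 <= m <= N)%nat ->
  (forall n, (1 <= n <= N)%nat -> n <> m -> f n = 0) -> csum f N = f m.
Proof.
  intros Hm H.
  rewrite (csum_trunc f m N); [|lia | intros; apply H; lia].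
  destruct m as [|m]; [lia|]. rewrite csum_S, csum_zero. ring.
  intros; apply H; lia.
Qed.

Definition rsum (f : nat -> R) (N : nat) : R := sum_n_m f 1 N.

Lemma rsum_0 f : rsum f 0 = 0%R.
Proof. unfold rsum. rewrite sum_n_m_zero; [reflexivity | lia]. Qed.

Lemma rsum_S f N : rsum f (S N) = (rsum f N + f (S N))%R.
Proof. unfold rsum. rewrite sum_n_Sm; [reflexivity | lia]. Qed.

Lemma Cmod_csum_le (f : nat -> C) N : (Cmod (csum f N) <= rsum (fun n => Cmod (f n))%R N)%R.
Proof.
  induction N as [|N IH].
  - rewrite csum_0, rsum_0, Cmod_0. lra.
  - rewrite csum_S, rsum_S. eapply Rle_trans; [apply Cmod_triangle|]. lra.
Qed.

Lemma rsum_le f g N : (forall n, (1 <= n <= N)%nat -> (f n <= g n)%R) ->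
  (rsum f N <= rsum g N)%R.
Proof.
  induction N as [|N IH]; intros H.
  - rewrite !rsum_0. lra.
  - rewrite !rsum_S. assert (f (S N) <= g (S N))%R by (apply H; lia).
    assert (rsum f N <= rsum g N)%R by (apply IH; intros; apply H; lia). lra.
Qed.

Lemma rsum_scal k f N : rsum (fun n => k * f n)%R N = (k * rsum f N)%R.
Proof.
  induction N as [|N IH]; [rewrite !rsum_0; ring | rewrite !rsum_S, IH; ring].
Qed.

Lemma Re_csum f N : Re (csum f N) = rsum (fun n => Re (f n))%R N.
Proof.
  induction N as [|N IH]; [rewrite csum_0, rsum_0; reflexivity|].
  rewrite csum_S, rsum_S, <- IH. reflexivity.
Qed.

Lemma Cmod_sub_rev (x y z : C) : (Cmod (x - z) <= Cmod (x - y) + Cmod (y - z))%R.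
Proof. replace (x - z) with ((x - y) + (y - z)) by ring. apply Cmod_triangle. Qed.

Lemma Cmod_le_add (x y : C) : (Cmod x <= Cmod y + Cmod (x - y))%R.
Proof. replace x with (y + (x - y)) at 1 by ring. apply Cmod_triangle. Qed.

Lemma Cmod_minus_sym (x y : C) : Cmod (x - y) = Cmod (y - x).
Proof. rewrite <- (Cmod_opp (x - y)). f_equal. ring. Qed.

Lemma C_eq_of_small (x y : C) :
  (forall eps, (0 < eps)%R -> (Cmod (x - y) <= eps)%R) -> x = y.
Proof.
  intros H. assert (Cmod (x - y) = 0%R).
  { apply Rle_antisym; [|apply Cmod_ge_0]. apply Rnot_lt_le. intros Hp.
    specialize (H (Cmod (x - y) / 2)%R ltac:(lra)). lra. }
  apply Cmod_eq_0 in H0. replace x with ((x - y) + y) by ring. rewrite H0. ring.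
Qed.

(** Metric form of convergence; the product uniform structure on C, in which
    [dirichlet_cv] is stated, gives the same notion with different balls. *)
Definition Clim (v : nat -> C) (l : C) : Prop :=
  forall eps : R, (0 < eps)%R -> exists N0 : nat, forall N, (N0 <= N)%nat ->
    (Cmod (v N - l) <= eps)%R.

Lemma filterlim_Clim (v : nat -> C) (l : C) :
  filterlim v eventually (locally l) <-> Clim v l.
Proof.
  split.
  - intros H eps Heps.
    assert (Hl : locally (T := C_UniformSpace) l (fun z => (Cmod (z - l) <= eps)%R)).
    { assert (0 < eps / sqrt 2)%R.
      { apply Rdiv_lt_0_compat; auto. apply sqrt_lt_R0. lra. }
      exists (mkposreal _ H0). intros y Hy.
      apply C_NormedModule_mixin_compat2 in Hy. simpl in Hy.
      left. change (Cmod (y - l) < eps)%R.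
      replace eps with (sqrt 2 * (eps / sqrt 2))%R. exact Hy.
      field. apply Rgt_not_eq, sqrt_lt_R0. lra. }
    destruct (H _ Hl) as [N0 HN]. exists N0. intros N HNN. apply (HN N HNN).
  - intros H P [eps HP].
    destruct (H (eps / 2)%R) as [N0 HN].
    { apply Rdiv_lt_0_compat; [apply cond_pos | lra]. }
    exists N0. intros N HNN. apply HP. apply C_NormedModule_mixin_compat1.
    change (Cmod (v N - l) < eps)%R. specialize (HN N HNN).
    pose proof (cond_pos eps). lra.
Qed.

Lemma Clim_unique v l l' : Clim v l -> Clim v l' -> l = l'.
Proof.
  intros H H'. apply C_eq_of_small. intros eps Heps.
  destruct (H (eps / 2)%R ltac:(lra)) as [N1 H1].
  destruct (H' (eps / 2)%R ltac:(lra)) as [N2 H2].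
  specialize (H1 (N1 + N2)%nat ltac:(lia)). specialize (H2 (N1 + N2)%nat ltac:(lia)).
  rewrite Cmod_minus_sym in H1.
  eapply Rle_trans; [apply (Cmod_sub_rev l (v (N1 + N2)%nat) l') | lra].
Qed.

Lemma Clim_ext v w l : (forall n, v n = w n) -> Clim v l -> Clim w l.
Proof.
  intros E H eps Heps. destruct (H eps Heps) as [N0 HN]. exists N0.
  intros N HNN. rewrite <- E. auto.
Qed.

Lemma Clim_const l : Clim (fun _ => l) l.
Proof.
  intros eps Heps. exists 0%nat. intros. replace (l - l) with (RtoC 0) by ring.
  rewrite Cmod_0. lra.
Qed.

Lemma Clim_plus v w l m : Clim v l -> Clim w m -> Clim (fun n => v n + w n) (l + m).
Proof.
  intros H H' eps Heps.
  destruct (H (eps / 2)%R ltac:(lra)) as [N1 H1].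
  destruct (H' (eps / 2)%R ltac:(lra)) as [N2 H2].
  exists (N1 + N2)%nat. intros N HN.
  specialize (H1 N ltac:(lia)). specialize (H2 N ltac:(lia)).
  replace (v N + w N - (l + m)) with ((v N - l) + (w N - m)) by ring.
  eapply Rle_trans; [apply Cmod_triangle | lra].
Qed.

Lemma Clim_mult v w l m : Clim v l -> Clim w m -> Clim (fun n => v n * w n) (l * m).
Proof.
  intros H H' eps Heps.
  pose proof (Cmod_ge_0 l) as Hl. pose proof (Cmod_ge_0 m) as Hm.
  set (e := Rmin 1 (eps / (2 + Cmod l + Cmod m))).
  assert (He : (0 < e)%R). { apply Rmin_pos; [lra|]. apply Rdiv_lt_0_compat; lra. }
  destruct (H e He) as [N1 H1]. destruct (H' e He) as [N2 H2].
  exists (N1 + N2)%nat. intros N HN.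
  specialize (H1 N ltac:(lia)). specialize (H2 N ltac:(lia)).
  replace (v N * w N - l * m) with ((v N - l) * (w N - m) + ((v N - l) * m + l * (w N - m))) by ring.
  eapply Rle_trans; [apply Cmod_triangle|].
  eapply Rle_trans; [apply Rplus_le_compat_l, Cmod_triangle|]. rewrite !Cmod_mult.
  assert (e <= 1)%R by apply Rmin_l.
  assert (e * (2 + Cmod l + Cmod m) <= eps)%R.
  { apply Rle_trans with (eps / (2 + Cmod l + Cmod m) * (2 + Cmod l + Cmod m))%R.
    apply Rmult_le_compat_r; [lra|apply Rmin_r]. right; field; lra. }
  pose proof (Cmod_ge_0 (v N - l)). pose proof (Cmod_ge_0 (w N - m)).
  assert (Cmod (v N - l) * Cmod (w N - m) <= e * 1)%R by (apply Rmult_le_compat; lra).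
  assert (Cmod (v N - l) * Cmod m <= e * Cmod m)%R by (apply Rmult_le_compat; lra).
  assert (Cmod l * Cmod (w N - m) <= Cmod l * e)%R by (apply Rmult_le_compat; lra).
  nra.
Qed.

Lemma Clim_Cmod_le v l M : (forall n, (Cmod (v n) <= M)%R) -> Clim v l -> (Cmod l <= M)%R.
Proof.
  intros HM H. apply Rnot_lt_le. intros Hlt.
  destruct (H ((Cmod l - M) / 2)%R ltac:(lra)) as [N0 HN].
  specialize (HN N0 (Nat.le_refl _)). specialize (HM N0).
  pose proof (Cmod_le_add l (v N0)) as HH. rewrite Cmod_minus_sym in HH. lra.
Qed.

(** * The complex exponential and the functions n^z *)

Lemma Cexp_plus z w : Cexp (z + w) = Cexp z * Cexp w.
Proof.
  destruct z as [a b], w as [x y]. unfold Cexp, Cmult, Cplus; simpl.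
  rewrite exp_plus, cos_plus, sin_plus. f_equal; ring.
Qed.

Lemma Cexp_0 : Cexp 0 = 1.
Proof. unfold Cexp; simpl. rewrite exp_0, cos_0, sin_0. unfold RtoC. f_equal; ring. Qed.

Lemma Cmod_Cexp z : Cmod (Cexp z) = exp (Re z).
Proof.
  destruct z as [a b]. unfold Cmod, Cexp; simpl.
  transitivity (sqrt (exp a * exp a)).
  - f_equal. pose proof (sin2_cos2 b) as H. unfold Rsqr in H.
    transitivity (exp a * exp a * (sin b * sin b + cos b * cos b))%R; [ring|rewrite H; ring].
  - apply sqrt_square. left; apply exp_pos.
Qed.

Lemma Cexp_neq_0 z : Cexp z <> 0.
Proof. apply Cmod_gt_0. rewrite Cmod_Cexp. apply exp_pos. Qed.

Lemma continuity_pt_of_is_derive (f : R -> R) x l : is_derive f x l -> continuity_pt f x.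
Proof.
  intros H. apply continuity_pt_filterlim.
  apply (@ex_derive_continuous R_AbsRing R_NormedModule). exists l; exact H.
Qed.

Lemma exp_quad x : (Rabs x <= 1 -> Rabs (exp x - 1 - x) <= x * x)%R.
Proof.
  intros Hx. apply Rabs_le_between in Hx.
  pose proof (exp_ineq1_le x) as H1.
  pose proof (exp_ineq1_le (- x)) as H2.
  assert (H3 : (exp x <= 1 + x + x * x)%R).
  { destruct (Rle_dec x 0) as [Hn|Hp].
    - assert (exp x * exp (- x) = 1)%R.
      { rewrite <- exp_plus. replace (x + - x)%R with 0%R by ring. apply exp_0. }
      pose proof (exp_pos x).
      assert (exp x * (1 - x) <= 1)%R by nra.
      nra.
    - assert (Hd : forall y, (0 <= y <= 1)%R -> (exp y <= 1 + y + y * y)%R).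
      { intros y Hy.
        assert (D : forall t, is_derive (fun t => 1 + t + t * t - exp t)%R t (1 + 2 * t - exp t)%R).
        { intros t. auto_derive; [trivial | ring]. }
        assert (E : forall t, (0 <= t <= 1)%R -> (exp t <= 1 + 2 * t)%R).
        { intros t Ht.
          (* convexity: exp lies below its chord on [0, 1], whose slope is at most 2 *)
          destruct (MVT_gen (fun t => exp t) 0 t (fun t => exp t)) as [c1 [Hc1 Hc2]].
          - intros; auto_derive; auto; ring.
          - intros; apply continuity_pt_filterlim, continuous_exp.
          - destruct (MVT_gen (fun t => exp t) t 1 (fun t => exp t)) as [c2 [Hc3 Hc4]].
            + intros; auto_derive; auto; ring.
            + intros; apply continuity_pt_filterlim, continuous_exp.
            + rewrite Rmin_left, Rmax_right in Hc1 by lra.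
              rewrite Rmin_left, Rmax_right in Hc3 by lra.
              rewrite exp_0 in Hc2. pose proof exp_le_3.
              assert (exp c1 <= exp c2)%R.
              { destruct (Req_dec c1 c2) as [->|]; [lra|]. left; apply exp_increasing. lra. }
              assert ((exp t - 1) * (1 - t) <= (exp 1 - exp t) * t)%R.
              { rewrite Hc2, Hc4. assert (0 <= t * (1 - t))%R by nra. nra. }
              nra. }
        destruct (MVT_gen (fun t => 1 + t + t * t - exp t)%R 0 y (fun t => 1 + 2 * t - exp t)%R) as [c [Hc1 Hc2]].
        - intros; apply D.
        - intros; eapply continuity_pt_of_is_derive, D.
        - rewrite Rmin_left, Rmax_right in Hc1 by lra.
          rewrite exp_0 in Hc2. specialize (E c ltac:(lra)).
          assert (0 <= (1 + 2 * c - exp c) * (y - 0))%R by (apply Rmult_le_pos; lra). lra. }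
      apply Hd; lra. }
  apply Rabs_le. split; nra.
Qed.

Lemma sin_le_abs z : (Rabs (sin z) <= Rabs z)%R.
Proof.
  destruct (MVT_gen sin 0 z cos) as [c [_ Hc]].
  - intros; auto_derive; auto; ring.
  - intros; apply continuity_pt_filterlim, continuous_sin.
  - rewrite sin_0, !Rminus_0_r in Hc. rewrite Hc, Rabs_mult.
    pose proof (COS_bound c). assert (Rabs (cos c) <= 1)%R by (apply Rabs_le; lra).
    pose proof (Rabs_pos z). nra.
Qed.

Lemma cos_quad y : (Rabs (cos y - 1) <= y * y / 2)%R.
Proof.
  assert (H : (cos y = 1 - 2 * (sin (y / 2) * sin (y / 2)))%R).
  { replace y with (2 * (y / 2))%R at 1 by field. rewrite cos_2a_sin. ring. }
  pose proof (sin_le_abs (y / 2)) as Hs.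
  rewrite H. replace (1 - 2 * (sin (y / 2) * sin (y / 2)) - 1)%R with (- (2 * (sin (y / 2) * sin (y / 2))))%R by ring.
  rewrite Rabs_Ropp, Rabs_right by nra.
  assert (sin (y/2) * sin (y/2) <= (y/2) * (y/2))%R.
  { apply Rsqr_le_abs_1 in Hs. exact Hs. }
  lra.
Qed.

Lemma sin_quad y : (Rabs y <= 1 -> Rabs (sin y - y) <= y * y)%R.
Proof.
  intros Hy.
  destruct (MVT_gen (fun t => sin t - t)%R 0 y (fun t => cos t - 1)%R) as [c [Hc1 Hc2]].
  - intros; auto_derive; auto; ring.
  - intros. eapply continuity_pt_of_is_derive. auto_derive; auto.
  - rewrite sin_0 in Hc2. replace (sin y - y)%R with ((cos c - 1) * (y - 0))%R by lra.
    rewrite Rabs_mult, Rminus_0_r.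
    assert (Rabs c <= Rabs y)%R.
    { unfold Rmin, Rmax in Hc1. destruct (Rle_dec 0 y).
      - rewrite !Rabs_right; lra.
      - rewrite !Rabs_left1; lra. }
    pose proof (cos_quad c).
    assert (Hcc : (c * c <= Rabs y)%R).
    { replace (c * c)%R with (Rabs c * Rabs c)%R by (unfold Rabs; destruct Rcase_abs; ring).
      pose proof (Rabs_pos c). nra. }
    replace (y * y)%R with (Rabs y * Rabs y)%R by (unfold Rabs; destruct Rcase_abs; ring).
    pose proof (Rabs_pos y). apply Rmult_le_compat_r; lra.
Qed.

Lemma Cmod_le_Re_Im z : (Cmod z <= Rabs (Re z) + Rabs (Im z))%R.
Proof.
  destruct z as [a b]. simpl.
  replace ((a, b) : C) with (RtoC a + Ci * RtoC b).
  - eapply Rle_trans; [apply Cmod_triangle|]. rewrite Cmod_mult, Cmod_Ci, !Cmod_R. lra.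
  - unfold RtoC, Ci, Cplus, Cmult; simpl. f_equal; ring.
Qed.

Lemma Im_le_Cmod z : (Rabs (Im z) <= Cmod z)%R.
Proof. eapply Rle_trans; [|apply Rmax_Cmod]. apply Rmax_r. Qed.

(** The second-order estimate from which both the complex derivative of the
    exponential and Euler's limit (1 + w/n)^n -> exp w are derived. *)
Lemma Cexp_quad z : (Cmod z <= 1)%R -> (Cmod (Cexp z - 1 - z) <= 6 * (Cmod z * Cmod z))%R.
Proof.
  intros Hz. eapply Rle_trans; [apply Cmod_le_Re_Im|].
  pose proof (re_le_Cmod z) as Hr. pose proof (Im_le_Cmod z) as Hi.
  destruct z as [x y]. simpl in *. set (r := Cmod (x, y)) in *.
  assert (Hx : (Rabs x <= 1)%R) by lra. assert (Hy : (Rabs y <= 1)%R) by lra.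
  pose proof (exp_quad x Hx) as E. pose proof (cos_quad y) as Co. pose proof (sin_quad y Hy) as Si.
  pose proof (sin_le_abs y) as Sl. pose proof (COS_bound y) as Cb.
  assert (xx : (x * x <= r * r)%R).
  { replace (x * x)%R with (Rabs x * Rabs x)%R by (unfold Rabs; destruct Rcase_abs; ring).
    pose proof (Rabs_pos x). nra. }
  assert (yy : (y * y <= r * r)%R).
  { replace (y * y)%R with (Rabs y * Rabs y)%R by (unfold Rabs; destruct Rcase_abs; ring).
    pose proof (Rabs_pos y). nra. }
  assert (A1 : (Rabs (exp x * cos y + - (1) + - x) <= 2 * (r * r))%R).
  { replace (exp x * cos y + - (1) + - x)%R with ((exp x - 1 - x) * cos y + (1 + x) * (cos y - 1))%R by ring.
    eapply Rle_trans; [apply Rabs_triang|]. rewrite !Rabs_mult.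
    assert (Rabs (cos y) <= 1)%R by (apply Rabs_le; lra).
    assert (Rabs (1 + x) <= 2)%R by (apply Rabs_le; apply Rabs_le_between in Hx; lra).
    pose proof (Rabs_pos (exp x - 1 - x)). pose proof (Rabs_pos (cos y - 1)).
    pose proof (Rabs_pos (cos y)). pose proof (Rabs_pos (1 + x)). 
    assert (Rabs (exp x - 1 - x) * Rabs (cos y) <= r * r * 1)%R by (apply Rmult_le_compat; lra).
    assert (Rabs (1 + x) * Rabs (cos y - 1) <= 2 * (r * r / 2))%R by (apply Rmult_le_compat; lra).
    lra. }
  assert (A2 : (Rabs (exp x * sin y + -0 + - y) <= 4 * (r * r))%R).
  { replace (exp x * sin y + -0 + - y)%R with ((exp x - 1 - x) * sin y + x * sin y + (sin y - y))%R by ring.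
    eapply Rle_trans; [apply Rabs_triang|].
    eapply Rle_trans; [apply Rplus_le_compat_r, Rabs_triang|]. rewrite !Rabs_mult.
    pose proof (Rabs_pos (exp x - 1 - x)). pose proof (Rabs_pos x). pose proof (Rabs_pos (sin y)).
    assert (Rabs (exp x - 1 - x) * Rabs (sin y) <= r * r * 1)%R by (apply Rmult_le_compat; lra).
    assert (Rabs x * Rabs (sin y) <= r * r)%R by (apply Rmult_le_compat; lra).
    lra. }
  unfold Cexp, Cminus, Cplus, Copp, RtoC; simpl in *. lra. 
Qed.

Lemma Cexp_lip z : (Cmod z <= 1)%R -> (Cmod (Cexp z - 1) <= 7 * Cmod z)%R.
Proof.
  intros Hz. pose proof (Cexp_quad z Hz) as H.
  pose proof (Cmod_le_add (Cexp z - 1) z) as H1. pose proof (Cmod_ge_0 z).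
  assert (Cmod z * Cmod z <= 1 * Cmod z)%R by (apply Rmult_le_compat_r; lra). lra.
Qed.

Lemma npow_plus n z w : npow n (z + w) = npow n z * npow n w.
Proof. unfold npow. rewrite <- Cexp_plus. f_equal. ring. Qed.

Lemma npow_0 n : npow n 0 = 1.
Proof. unfold npow. rewrite Cmult_0_r. apply Cexp_0. Qed.

Lemma npow_neq_0 n z : npow n z <> 0.
Proof. apply Cexp_neq_0. Qed.

Lemma npow_opp n z : npow n z * npow n (- z) = 1.
Proof. rewrite <- npow_plus. replace (z + - z) with (RtoC 0) by ring. apply npow_0. Qed.

Lemma npow_1 z : npow 1 z = 1.
Proof. unfold npow. simpl. rewrite ln_1, Cmult_0_l. apply Cexp_0. Qed.

Lemma Cmod_npow n z : Cmod (npow n z) = exp (ln (INR n) * Re z).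
Proof. unfold npow. rewrite Cmod_Cexp. f_equal. destruct z; simpl. ring. Qed.

Lemma npow_mult n m z : (1 <= n)%nat -> (1 <= m)%nat ->
  npow (n * m) z = npow n z * npow m z.
Proof.
  intros Hn Hm. unfold npow. rewrite <- Cexp_plus. f_equal.
  rewrite mult_INR, ln_mult, RtoC_plus; try (apply lt_0_INR; lia). ring.
Qed.

Lemma INR_ge_1 n : (1 <= n)%nat -> (1 <= INR n)%R.
Proof. intros H. apply le_INR in H. simpl in H. exact H. Qed.

Lemma ln_INR_ge_0 n : (1 <= n)%nat -> (0 <= ln (INR n))%R.
Proof. intros H. rewrite <- ln_1. apply ln_le; [lra | apply INR_ge_1; auto]. Qed.

Lemma ln_INR_lt n m : (1 <= n)%nat -> (n < m)%nat -> (ln (INR n) < ln (INR m))%R.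
Proof. intros H H'. apply ln_increasing; [apply lt_0_INR; lia | apply lt_INR; auto]. Qed.

Lemma Cmod_npow_le_1 n s : (1 <= n)%nat -> (0 <= Re s)%R -> (Cmod (npow n (- s)) <= 1)%R.
Proof.
  intros Hn Hs. rewrite Cmod_npow, <- exp_0. pose proof (ln_INR_ge_0 n Hn).
  assert (ln (INR n) * Re (- s) <= 0)%R by (destruct s; simpl in *; nra).
  destruct H0 as [H0|H0]; [left; apply exp_increasing; auto | rewrite H0; lra].
Qed.

Lemma exp_le x y : (x <= y -> exp x <= exp y)%R.
Proof. intros [H|H]; [left; apply exp_increasing; auto | rewrite H; lra]. Qed.

(** * The Fourier multipliers given by second differences of |x| *)

(** The integral of this function of [t] over (0, +oo) is a constant times
    |x|, by the substitution t -> t/|x|. At [t = 0] its value is arbitrary, so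
    integrals are taken over [1/T, T]. *)
Definition cos_kernel (x t : R) : R := ((1 - cos (x * t)) / (t * t))%R.

Lemma continuous_cos_kernel x t : t <> 0%R -> continuous (cos_kernel x) t.
Proof.
  intros Ht. apply (@ex_derive_continuous R_AbsRing R_NormedModule).
  unfold cos_kernel. auto_derive. nra.
Qed.

Lemma ex_RInt_cos_kernel x a b : (0 < a)%R -> (0 < b)%R -> ex_RInt (cos_kernel x) a b.
Proof.
  intros Ha Hb. apply (@ex_RInt_continuous R_CompleteNormedModule). intros z Hz.
  apply continuous_cos_kernel. assert (0 < Rmin a b)%R by (apply Rmin_pos; auto). lra.
Qed.

Lemma cos_kernel_ge_0 x t : (0 <= cos_kernel x t)%R.
Proof.
  unfold cos_kernel. pose proof (COS_bound (x * t)).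
  destruct (Req_dec t 0) as [->|Ht].
  - rewrite Rmult_0_l. unfold Rdiv. rewrite Rinv_0. lra.
  - apply Rmult_le_pos; [lra|]. left. apply Rinv_0_lt_compat. nra.
Qed.

Lemma RInt_cos_kernel_mono a b a' b' : (0 < a' <= a)%R -> (a <= b)%R -> (b <= b')%R ->
  (RInt (cos_kernel 1) a b <= RInt (cos_kernel 1) a' b')%R.
Proof.
  intros [Ha' Ha] Hab Hb.
  rewrite <- (RInt_Chasles (V := R_CompleteNormedModule) (cos_kernel 1) a' a b') by (apply ex_RInt_cos_kernel; lra).
  rewrite <- (RInt_Chasles (V := R_CompleteNormedModule) (cos_kernel 1) a b b') by (apply ex_RInt_cos_kernel; lra).
  change plus with Rplus.
  assert (0 <= RInt (cos_kernel 1) a' a)%R.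
  { apply RInt_ge_0; auto. apply ex_RInt_cos_kernel; lra. intros; apply cos_kernel_ge_0. }
  assert (0 <= RInt (cos_kernel 1) b b')%R.
  { apply RInt_ge_0; auto. apply ex_RInt_cos_kernel; lra. intros; apply cos_kernel_ge_0. }
  unfold plus; simpl. lra.
Qed.

Lemma RInt_cos_kernel_bound a b : (0 < a <= b)%R -> (RInt (cos_kernel 1) a b <= 3)%R.
Proof.
  intros [Ha Hab].
  set (a' := Rmin a 1). set (b' := Rmax b 1).
  assert (Ha' : (0 < a')%R) by (apply Rmin_pos; lra).
  assert (a' <= 1)%R by apply Rmin_r. assert (1 <= b')%R by apply Rmax_r.
  eapply Rle_trans; [apply (RInt_cos_kernel_mono a b a' b'); auto|].
  { split; auto. apply Rmin_l. } { apply Rmax_l. }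
  rewrite <- (RInt_Chasles (V := R_CompleteNormedModule) (cos_kernel 1) a' 1 b') by (apply ex_RInt_cos_kernel; lra).
  assert (H1 : (RInt (cos_kernel 1) a' 1 <= 1)%R).
  { apply Rle_trans with (RInt (fun _ => 1 : R)%R a' 1).
    - apply RInt_le; auto. apply ex_RInt_cos_kernel; lra. apply ex_RInt_const.
      intros x Hx. unfold cos_kernel. rewrite Rmult_1_l. pose proof (cos_quad x) as Hc.
      apply Rabs_le_between in Hc.
      apply Rmult_le_reg_r with (x * x)%R; [nra|].
      replace ((1 - cos x) / (x * x) * (x * x))%R with (1 - cos x)%R by (field; lra). nra.
    - rewrite RInt_const. unfold scal; simpl. unfold mult; simpl. lra. }
  assert (H2 : (RInt (cos_kernel 1) 1 b' <= 2)%R).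
  { assert (I : is_RInt (fun t => 2 / (t * t))%R 1 b' (minus (- 2 / b') (- 2 / 1))%R).
    { apply (is_RInt_derive (V := R_CompleteNormedModule) (fun t => - 2 / t)%R).
      - intros x Hx. rewrite Rmin_left in Hx by auto. auto_derive; [lra|field; lra].
      - intros x Hx. rewrite Rmin_left in Hx by auto.
        apply (@ex_derive_continuous R_AbsRing R_NormedModule). auto_derive. nra. }
    apply Rle_trans with (RInt (fun t => 2 / (t * t))%R 1 b').
    - apply RInt_le; auto. apply ex_RInt_cos_kernel; lra. eexists; apply I.
      intros x Hx. unfold cos_kernel. rewrite Rmult_1_l. pose proof (COS_bound x).
      apply Rmult_le_compat_r; [|lra]. left; apply Rinv_0_lt_compat; nra.
    - rewrite (is_RInt_unique _ _ _ _ I). unfold minus, plus, opp; simpl.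
      assert (0 < / b')%R by (apply Rinv_0_lt_compat; lra). unfold Rdiv. rewrite Rinv_1. lra. }
  unfold plus; simpl. lra.
Qed.

Lemma RInt_cos_kernel_scale x a b : (0 < x)%R -> (0 < a)%R -> (0 < b)%R ->
  RInt (cos_kernel x) a b = (x * RInt (cos_kernel 1) (x * a) (x * b))%R.
Proof.
  intros Hx Ha Hb.
  assert (I : is_RInt (cos_kernel 1) (x * a + 0) (x * b + 0) (RInt (cos_kernel 1) (x * a) (x * b))).
  { rewrite !Rplus_0_r. apply (@RInt_correct R_CompleteNormedModule).
    apply ex_RInt_cos_kernel; apply Rmult_lt_0_compat; auto. }
  apply (is_RInt_comp_lin (V := R_NormedModule)) in I.
  apply (is_RInt_scal (V := R_NormedModule) _ _ _ x) in I.
  apply is_RInt_unique.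
  refine (is_RInt_ext _ _ _ _ _ _ I).
  intros t Ht. assert (0 < Rmin a b)%R by (apply Rmin_pos; auto).
  change (x * (x * cos_kernel 1 (x * t + 0)) = cos_kernel x t)%R. unfold cos_kernel.
  replace (1 * (x * t + 0))%R with (x * t)%R by ring. field. lra.
Qed.

Lemma cos_kernel_abs x : forall t, cos_kernel (Rabs x) t = cos_kernel x t.
Proof.
  intros t. unfold cos_kernel, Rabs. destruct (Rcase_abs x); auto.
  replace (- x * t)%R with (- (x * t))%R by ring. rewrite cos_neg. reflexivity.
Qed.

(** The constant is the supremum of the integrals of [cos_kernel 1] over compact subintervals of (0, +oo),
    finite because the kernel is at most 1/2 near 0 and at most 2/t^2 at
    infinity; homogeneity then gives every other [x]. *)
Lemma abs_cos_integral : exists c : R, (0 < c)%R /\ forall x : R,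
  is_lim_seq (fun k => RInt (cos_kernel x) (/ INR (S k)) (INR (S k))) (c * Rabs x)%R.
Proof.
  set (E := fun y => exists a b, (0 < a <= b)%R /\ y = RInt (cos_kernel 1) a b).
  destruct (completeness E) as [c [Hub Hlub]].
  { exists 3%R. intros y [a [b [Hab ->]]]. apply RInt_cos_kernel_bound; auto. }
  { exists (RInt (cos_kernel 1) 1 1), 1%R, 1%R. split; [lra|auto]. }
  exists c. split.
  { apply Rlt_le_trans with (RInt (cos_kernel 1) 1 2).
    - apply RInt_gt_0; [lra| |].
      + intros x Hx. unfold cos_kernel. rewrite Rmult_1_l. apply Rdiv_lt_0_compat; [|nra].
        assert (cos x < cos 0)%R.
        { pose proof PI2_1. apply cos_decreasing_1; lra. }
        rewrite cos_0 in H. lra.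
      + intros x Hx. apply continuous_cos_kernel. lra.
    - apply Hub. exists 1%R, 2%R. split; [lra|auto]. }
  intros x. destruct (Req_dec x 0) as [->|Hx].
  { rewrite Rabs_R0, Rmult_0_r. apply is_lim_seq_ext with (fun _ => 0%R); [|apply is_lim_seq_const].
    intros k. rewrite (RInt_ext _ (fun _ => 0%R)).
    - rewrite RInt_const. unfold scal; simpl; unfold mult; simpl. ring.
    - intros t _. unfold cos_kernel. rewrite Rmult_0_l, cos_0. unfold Rdiv. rewrite Rminus_diag. apply Rmult_0_l. }
  set (y := Rabs x). assert (Hy : (0 < y)%R) by (apply Rabs_pos_lt; auto).
  apply is_lim_seq_ext with (fun k => RInt (cos_kernel y) (/ INR (S k)) (INR (S k))).
  { intros k. apply RInt_ext. intros t _. apply cos_kernel_abs. }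
  apply is_lim_seq_spec. intros [eps Heps]. simpl pos.
  assert (Hc : exists a b, (0 < a <= b)%R /\ (c - eps / y < RInt (cos_kernel 1) a b)%R).
  { apply NNPP. intros Hn. assert (c <= c - eps / y)%R.
    { apply Hlub. intros z [a [b [Hab ->]]]. apply Rnot_lt_le. intros Hlt. apply Hn.
      exists a, b; auto. }
    assert (0 < eps / y)%R by (apply Rdiv_lt_0_compat; auto). lra. }
  destruct Hc as [a [b [Hab Hlt]]].
  destruct (nfloor_ex (y / a + b / y)) as [k0 [_ Hk0]].
  { assert (0 < y / a)%R by (apply Rdiv_lt_0_compat; lra).
    assert (0 < b / y)%R by (apply Rdiv_lt_0_compat; lra). lra. }
  exists k0. intros k Hk.
  assert (HT : (y / a + b / y < INR (S k))%R).
  { rewrite S_INR. apply le_INR in Hk. lra. }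
  set (T := INR (S k)) in *.
  assert (H1 : (0 < y / a)%R) by (apply Rdiv_lt_0_compat; lra).
  assert (H2 : (0 < b / y)%R) by (apply Rdiv_lt_0_compat; lra).
  assert (HTp : (0 < T)%R) by lra.
  assert (Hiv : (0 < / T)%R) by (apply Rinv_0_lt_compat; lra).
  rewrite RInt_cos_kernel_scale by auto.
  assert (Ha : (y * / T <= a)%R).
  { apply Rmult_le_reg_r with T; auto. rewrite Rmult_assoc, Rinv_l, Rmult_1_r by lra.
    assert (y / a * a <= T * a)%R by (apply Rmult_le_compat_r; lra).
    replace (y / a * a)%R with y in H by (field; lra). lra. }
  assert (Hb : (b <= y * T)%R).
  { assert (b / y * y <= T * y)%R by (apply Rmult_le_compat_r; lra).
    replace (b / y * y)%R with b in H by (field; lra). lra. }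
  assert (L : (RInt (cos_kernel 1) a b <= RInt (cos_kernel 1) (y * / T) (y * T))%R).
  { apply RInt_cos_kernel_mono; try lra. split; nra. }
  assert (U : (RInt (cos_kernel 1) (y * / T) (y * T) <= c)%R).
  { apply Hub. exists (y * / T)%R, (y * T)%R. split; [split; nra | auto]. }
  rewrite Rabs_left1 by nra.
  assert (y * (eps / y) = eps)%R by (field; lra). nra.
Qed.

(** This is 2h times the triangle function of height 1 supported on [-h, h]. *)
Definition second_diff (h y : R) : R := (Rabs (y + h) + Rabs (y - h) - 2 * Rabs y)%R.

Arguments second_diff (h y)%_R_scope.

Lemma is_RInt_rsum (b : nat -> R) (G : nat -> R -> R) (I : nat -> R) u v N :
  (forall n, is_RInt (G n) u v (I n)) ->
  is_RInt (fun t => rsum (fun n => b n * G n t)%R N) u v (rsum (fun n => b n * I n)%R N).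
Proof.
  intros H. induction N as [|N IH].
  - rewrite rsum_0. apply is_RInt_ext with (fun _ => 0%R).
    { intros; rewrite rsum_0; auto. }
    pose proof (@is_RInt_const R_NormedModule u v 0%R) as H0.
    unfold scal in H0; simpl in H0; unfold mult in H0; simpl in H0.
    rewrite Rmult_0_r in H0. exact H0.
  - rewrite rsum_S. apply is_RInt_ext with (fun t => plus (rsum (fun n => b n * G n t)%R N) (scal (b (S N)) (G (S N) t))).
    { intros; rewrite rsum_S; auto. }
    apply (@is_RInt_plus R_NormedModule); auto.
    apply (@is_RInt_scal R_NormedModule); auto.
Qed.

Lemma is_lim_seq_rsum (b : nat -> R) (J : nat -> nat -> R) (L : nat -> R) N :
  (forall n, is_lim_seq (J n) (L n)) ->
  is_lim_seq (fun k => rsum (fun n => b n * J n k)%R N) (rsum (fun n => b n * L n)%R N).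
Proof.
  intros H. induction N as [|N IH].
  - rewrite rsum_0. apply is_lim_seq_ext with (fun _ => 0%R); [|apply is_lim_seq_const].
    intros; rewrite rsum_0; auto.
  - rewrite rsum_S. eapply is_lim_seq_ext; [intros k; symmetry; apply rsum_S|].
    apply (is_lim_seq_plus' _ _ _ _ IH).
    apply (is_lim_seq_scal_l (J (S N)) (b (S N)) (L (S N))); auto.
Qed.

Lemma rsum_ext f g N : (forall n, (1 <= n <= N)%nat -> f n = g n) -> rsum f N = rsum g N.
Proof. intros H. apply Rle_antisym; apply rsum_le; intros; rewrite H; auto; lra. Qed.

(** Positivity of the Fejer kernel. Taking the second difference in [x] of (1
    - cos (x t)) / t^2 gives 2 cos (x t) (1 - cos (h t)) / t^2, a nonnegative
    weight times cos (x t); integrating a bound on the cosine sum against this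
    weight, of total mass proportional to 2h, yields the claim. *)
Lemma second_diff_cos_bound (b x : nat -> R) N M h : (0 <= h)%R ->
  (forall t, (rsum (fun n => b n * cos (x n * t))%R N <= M)%R) ->
  (rsum (fun n => b n * second_diff h (x n))%R N <= 2 * h * M)%R.
Proof.
  intros Hh HM. destruct abs_cos_integral as [c [Hc HJ]].
  set (J := fun y k => RInt (cos_kernel y) (/ INR (S k)) (INR (S k))) in *.
  assert (Hmain : (rsum (fun n => b n * (c * second_diff h (x n)))%R N <= M * (2 * (c * h)))%R).
  { set (u1 := fun k => rsum (fun n => b n * (J (x n + h) k + J (x n - h) k - 2 * J (x n) k))%R N).
    set (u2 := fun k => (M * (2 * J h k))%R).
    assert (L1 : is_lim_seq u1 (rsum (fun n => b n * (c * second_diff h (x n)))%R N)).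
    { apply is_lim_seq_rsum. intros n.
      replace (c * second_diff h (x n))%R with (c * Rabs (x n + h) + c * Rabs (x n - h) - 2 * (c * Rabs (x n)))%R
        by (unfold second_diff; ring).
      apply is_lim_seq_minus'; [apply is_lim_seq_plus'|]; try apply HJ.
      apply (is_lim_seq_scal_l _ 2 (c * Rabs (x n))%R), HJ. }
    assert (L2 : is_lim_seq u2 (M * (2 * (c * h)))%R).
    { apply (is_lim_seq_scal_l _ M (2 * (c * h))%R), (is_lim_seq_scal_l _ 2 (c * h)%R).
      rewrite <- (Rabs_right h) at 2 by lra. apply HJ. }
    refine (is_lim_seq_le _ _ (Finite _) (Finite _) _ L1 L2). intros k.
    assert (HT : (1 <= INR (S k))%R) by (apply INR_ge_1; lia).
    set (T := INR (S k)) in *.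
    assert (Hi : (0 < / T <= 1)%R).
    { split. apply Rinv_0_lt_compat; lra. rewrite <- Rinv_1. apply Rinv_le_contravar; lra. }
    assert (I0 : forall y, is_RInt (cos_kernel y) (/ T) T (J y k)).
    { intros y. apply (@RInt_correct R_CompleteNormedModule). apply ex_RInt_cos_kernel; lra. }
    assert (I1 : is_RInt (fun t => rsum (fun n => b n * (cos_kernel (x n + h) t + cos_kernel (x n - h) t - 2 * cos_kernel (x n) t))%R N) (/ T) T (u1 k)).
    { apply (is_RInt_rsum b (fun n t => cos_kernel (x n + h) t + cos_kernel (x n - h) t - 2 * cos_kernel (x n) t)%R).
      intros n. apply (@is_RInt_minus R_NormedModule); [apply (@is_RInt_plus R_NormedModule)|]; auto.
      apply (@is_RInt_scal R_NormedModule); auto. }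
    assert (I2 : is_RInt (fun t => M * (2 * cos_kernel h t))%R (/ T) T (u2 k)).
    { apply (@is_RInt_scal R_NormedModule). apply (@is_RInt_scal R_NormedModule). auto. }
    refine (is_RInt_le _ _ _ _ _ _ _ I1 I2 _); [lra|].
    intros t Ht.
    rewrite (rsum_ext _ (fun n => (2 * cos_kernel h t) * (b n * cos (x n * t)))%R).
    - rewrite rsum_scal. rewrite (Rmult_comm M). apply Rmult_le_compat_l; auto.
      pose proof (cos_kernel_ge_0 h t); lra.
    - intros n _. unfold cos_kernel.
      replace ((x n + h) * t)%R with (x n * t + h * t)%R by ring.
      replace ((x n - h) * t)%R with (x n * t - h * t)%R by ring.
      rewrite cos_plus, cos_minus. field. lra. }
  rewrite (rsum_ext _ (fun n => c * (b n * second_diff h (x n)))%R) in Hmain by (intros; ring).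
  rewrite rsum_scal in Hmain. apply Rmult_le_reg_l with c; auto. lra.
Qed.

Definition cis (t : R) : C := (cos t, sin t).

Arguments cis t%_R_scope.

Lemma cis_plus a b : cis (a + b) = cis a * cis b.
Proof. unfold cis, Cmult; simpl. rewrite cos_plus, sin_plus. f_equal; ring. Qed.

Lemma Cmod_cis a : Cmod (cis a) = 1%R.
Proof.
  unfold Cmod, cis; simpl. transitivity (sqrt 1); [f_equal | apply sqrt_1].
  pose proof (sin2_cos2 a) as H. unfold Rsqr in H. lra.
Qed.

Lemma Cmod_unimodular_Re (z : C) : exists w : C, Cmod w = 1%R /\ w * z = RtoC (Cmod z).
Proof.
  destruct (Ceq_dec z 0) as [->|Hz].
  - exists 1. rewrite Cmod_1, Cmod_0. split; auto. ring.
  - assert (Hp : (0 < Cmod z)%R) by (apply Cmod_gt_0; auto).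
    exists (Cconj z / RtoC (Cmod z)). split.
    + rewrite Cmod_div, Cmod_conj, Cmod_R, Rabs_right. field; lra. lra.
      intros H; apply RtoC_inj in H; lra.
    + pose proof (Cmod2_conj z) as H.
      replace (Cconj z / RtoC (Cmod z) * z) with ((z * Cconj z) / RtoC (Cmod z)).
      * rewrite <- H. simpl. rewrite !RtoC_mult. field. intros E; apply RtoC_inj in E; lra.
      * field. intros E; apply RtoC_inj in E; lra.
Qed.

(** Reduction to cosines: rotate the sum onto the positive real axis, multiply
    the exponential sum by the unimodular factor that recentres the
    frequencies at [c], and average over t and -t. *)
Lemma second_diff_expsum_bound (z : nat -> C) (x : nat -> R) N M h c : (0 <= h)%R ->
  (forall t, (Cmod (csum (fun n => z n * cis (x n * t))%C N) <= M)%R) ->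
  (Cmod (csum (fun n => z n * RtoC (second_diff h (x n - c)))%C N) <= 2 * h * M)%R.
Proof.
  intros Hh HM.
  destruct (Cmod_unimodular_Re (csum (fun n => z n * RtoC (second_diff h (x n - c)))%C N)) as [w [Hw1 Hw]].
  assert (E : Cmod (csum (fun n => z n * RtoC (second_diff h (x n - c)))%C N)
    = rsum (fun n => Re (w * z n)%C * second_diff h (x n - c))%R N).
  { transitivity (Re (w * csum (fun n => z n * RtoC (second_diff h (x n - c)))%C N)).
    - rewrite Hw. reflexivity.
    - rewrite <- csum_scal, Re_csum. apply rsum_ext. intros n _.
      destruct (z n), w; simpl; ring. }
  rewrite E. apply second_diff_cos_bound; auto.
  intros t.
  assert (P : forall t, (Re (w * (cis (- c * t) * csum (fun n => z n * cis (x n * t)%R)%C N))%C <= M)%R).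
  { intros t'. eapply Rle_trans; [apply Rle_abs|]. eapply Rle_trans; [apply re_le_Cmod|].
    rewrite !Cmod_mult, Hw1, Cmod_cis, !Rmult_1_l. apply HM. }
  assert (Q : (2 * rsum (fun n => Re (w * z n)%C * cos ((x n - c) * t))%R N =
    Re (w * (cis (- c * t) * csum (fun n => z n * cis (x n * t)%R)%C N))%C
    + Re (w * (cis (- c * (- t)) * csum (fun n => z n * cis (x n * (- t))%R)%C N))%C)%R).
  { rewrite <- !csum_scal, !Re_csum.
    clear. induction N as [|N IH]; [rewrite !rsum_0; ring|]. rewrite !rsum_S.
    rewrite Rmult_plus_distr_l, IH.
    assert (Hn : forall u, cis (- c * u) * (z (S N) * cis (x (S N) * u)) = z (S N) * cis ((x (S N) - c) * u)).
    { intros u. replace ((x (S N) - c) * u)%R with (- c * u + x (S N) * u)%R by ring.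
      rewrite cis_plus. ring. }
    rewrite !Hn. unfold cis.
    replace ((x (S N) - c) * - t)%R with (- ((x (S N) - c) * t))%R by ring.
    rewrite cos_neg, sin_neg. destruct (z (S N)), w; simpl. ring. }
  pose proof (P t). pose proof (P (- t)%R). lra.
Qed.

Lemma Cmod_scal_R (k : R) (z : C) : Cmod (RtoC k * z) = (Rabs k * Cmod z)%R.
Proof. rewrite Cmod_mult, Cmod_R. auto. Qed.

(** The piecewise linear function equal to 1 up to [a] and to 0 from [a + h]
    on. *)
Definition ramp (a h x : R) : R := ((Rabs (x - a - h) - Rabs (x - a) + h) / (2 * h))%R.

Arguments ramp (a h x)%_R_scope.

(** Halving the width of the ramp subtracts half a triangle, which costs only
    M/2 whatever the width; hence a ramp of width 2^(-J) costs O(J) and not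
    O(2^J). The ramp of width 1 is, on nonnegative frequencies, a difference
    of two triangles centred at 0. *)
Lemma ramp_halving (z : nat -> C) (x : nat -> R) N M a J : (0 <= a)%R ->
  (forall n, (0 <= x n)%R) ->
  (forall t, (Cmod (csum (fun n => z n * cis (x n * t))%C N) <= M)%R) ->
  (Cmod (csum (fun n => z n * RtoC (ramp a (/ 2 ^ J) (x n)))%C N) <= (2 * a + 1 + INR J) * M)%R.
Proof.
  intros Ha Hx HM.
  assert (HM0 : (0 <= M)%R) by (eapply Rle_trans; [apply Cmod_ge_0 | apply (HM 0%R)]).
  induction J as [|J IH].
  - rewrite (csum_ext _ (fun n => RtoC (/2) * (z n * RtoC (second_diff (a + 1) (x n - 0)))
        - RtoC (/2) * (z n * RtoC (second_diff a (x n - 0))))).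
    + rewrite csum_minus, !csum_scal. unfold Cminus.
      eapply Rle_trans; [apply Cmod_triangle|]. rewrite Cmod_opp, !Cmod_scal_R, Rabs_right by lra.
      pose proof (second_diff_expsum_bound z x N M (a + 1) 0 ltac:(lra) HM).
      pose proof (second_diff_expsum_bound z x N M a 0 Ha HM). simpl. nra.
    + intros n _. transitivity (z n * (RtoC (/2 * second_diff (a + 1) (x n - 0) - /2 * second_diff a (x n - 0)))).
      * f_equal. f_equal. unfold ramp, second_diff. simpl. rewrite Rinv_1.
        rewrite !Rminus_0_r. rewrite (Rabs_right (x n + (a + 1))), (Rabs_right (x n + a)) by (specialize (Hx n); lra).
        replace (x n - a - 1)%R with (x n - (a + 1))%R by ring. field.
      * rewrite RtoC_minus, !RtoC_mult. ring.
  - set (h := (/ 2 ^ S J)%R). assert (Hh : (0 < h)%R) by (apply Rinv_0_lt_compat, pow_lt; lra).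
    assert (E : (/ 2 ^ J = 2 * h)%R). { unfold h. simpl. field. apply pow_nonzero; lra. }
    rewrite E in IH.
    rewrite (csum_ext _ (fun n => z n * RtoC (ramp a (2 * h) (x n))
        - RtoC (/ (4 * h)) * (z n * RtoC (second_diff h (x n - (a + h)))))).
    + rewrite csum_minus, !csum_scal. unfold Cminus.
      eapply Rle_trans; [apply Cmod_triangle|]. rewrite Cmod_opp, Cmod_scal_R.
      assert (0 < / (4 * h))%R by (apply Rinv_0_lt_compat; lra). rewrite Rabs_right by lra.
      pose proof (second_diff_expsum_bound z x N M h (a + h) ltac:(lra) HM) as S.
      apply Rmult_le_compat_l with (r := (/ (4 * h))%R) in S; [|lra].
      replace (/ (4 * h) * (2 * h * M))%R with (M / 2)%R in S by (field; lra).
      rewrite S_INR. lra.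
    + intros n _. transitivity (z n * (RtoC (ramp a (2 * h) (x n) - / (4 * h) * second_diff h (x n - (a + h))))).
      * f_equal. f_equal. unfold ramp, second_diff.
        replace (x n - (a + h) + h)%R with (x n - a)%R by ring.
        replace (x n - (a + h) - h)%R with (x n - a - 2 * h)%R by ring.
        replace (x n - (a + h))%R with (x n - a - h)%R by ring. field. lra.
      * rewrite RtoC_minus, !RtoC_mult. ring.
Qed.

Lemma ln_succ_ratio N : (1 <= N)%nat -> (/ (INR N + 1) <= ln (INR (S N)) - ln (INR N))%R.
Proof.
  intros HN. pose proof (INR_ge_1 N HN). rewrite S_INR.
  assert (H1 : (ln (INR N) - ln (INR N + 1) <= - / (INR N + 1))%R).
  { rewrite <- ln_div by lra.
    assert (0 < INR N / (INR N + 1))%R by (apply Rdiv_lt_0_compat; lra).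
    pose proof (exp_ineq1_le (ln (INR N / (INR N + 1)))) as HH.
    rewrite exp_ln in HH by auto.
    replace (- / (INR N + 1))%R with (INR N / (INR N + 1) - 1)%R by (field; lra). lra. }
  lra.
Qed.

(** Consecutive frequencies ln N and ln (N+1) differ by at least 1/(N+1), so a
    ramp of width 2^(-J) <= 1/(N+1) is a sharp cut-off on the frequencies ln
    n. With 2^J comparable to N this is Bohr's logarithmic bound for
    truncation. *)
Lemma truncation_log_bound (z : nat -> C) N K M J : (1 <= N)%nat -> (INR N + 1 <= 2 ^ J)%R ->
  (forall t, (Cmod (csum (fun n => z n * cis (ln (INR n) * t))%C K) <= M)%R) ->
  (N <= K)%nat ->
  (Cmod (csum z N) <= (2 * ln (INR N) + 1 + INR J) * M)%R.
Proof.
  intros HN HJ HM HK. pose proof (INR_ge_1 N HN) as HN1.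
  (* [Nat.max 1 n] gives index 0, outside the range of summation, a nonnegative
     frequency as well *)
  assert (Hx : forall n, (0 <= ln (INR (Nat.max 1 n)))%R) by (intros; apply ln_INR_ge_0; lia).
  pose proof (ramp_halving z (fun n => ln (INR (Nat.max 1 n))) K M (ln (INR N)) J (ln_INR_ge_0 N HN) Hx) as R.
  assert (E : csum (fun n => z n * RtoC (ramp (ln (INR N)) (/ 2 ^ J) (ln (INR (Nat.max 1 n)))))%C K = csum z N).
  { set (h := (/ 2 ^ J)%R). assert (Hh : (0 < h)%R) by (apply Rinv_0_lt_compat, pow_lt; lra).
    assert (Hh2 : (h <= ln (INR (S N)) - ln (INR N))%R).
    { eapply Rle_trans; [|apply ln_succ_ratio; auto]. apply Rinv_le_contravar; lra. }
    rewrite (csum_trunc _ N K HK).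
    - apply csum_ext. intros n Hn. rewrite Nat.max_r by lia.
      assert (ln (INR n) <= ln (INR N))%R.
      { apply ln_le. apply lt_0_INR; lia. apply le_INR; lia. }
      unfold ramp. rewrite !Rabs_left1 by lra.
      replace ((- (ln (INR n) - ln (INR N) - h) - - (ln (INR n) - ln (INR N)) + h) / (2 * h))%R with 1%R by (field; lra).
      ring.
    - intros n Hn. rewrite Nat.max_r by lia.
      assert (ln (INR (S N)) <= ln (INR n))%R.
      { apply ln_le. apply lt_0_INR; lia. apply le_INR; lia. }
      unfold ramp. rewrite !Rabs_right by lra.
      replace ((ln (INR n) - ln (INR N) - h - (ln (INR n) - ln (INR N)) + h) / (2 * h))%R with 0%R by (field; lra).
      ring. }
  cbv beta in R. rewrite E in R. apply R. intros t.
  rewrite (csum_ext _ (fun n => z n * cis (ln (INR n) * t))); auto.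
  intros n Hn. rewrite Nat.max_r by lia. auto.
Qed.

(** * Bohr's theorem for uniform limits of Dirichlet polynomials *)

(** The real power n^b. *)
Definition rpow (b : R) (n : nat) : R := exp (b * ln (INR n)).

Arguments rpow b%_R_scope n%_nat_scope.

Lemma log_bound_rpow b : (0 < b)%R -> exists c : R, (0 < c)%R /\
  forall N, (1 <= N)%nat -> exists J, (INR N + 1 <= 2 ^ J)%R /\
    (2 * ln (INR N) + 1 + INR J <= c * rpow b N)%R.
Proof.
  (* the least J is at most 2 ln N + 1, and ln N <= N^b / b *)
  intros Hb. exists (4 / b + 2)%R.
  assert (Hib : (0 < 4 / b)%R) by (apply Rdiv_lt_0_compat; lra).
  split; [lra|]. intros N HN. pose proof (ln_INR_ge_0 N HN) as Hl.
  exists (S (Nat.log2 N)). destruct (Nat.log2_spec N ltac:(lia)) as [H1 H2].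
  split.
  - rewrite <- S_INR. replace 2%R with (INR 2) by reflexivity. rewrite <- pow_INR. apply le_INR. lia.
  - assert (INR (Nat.log2 N) <= 2 * ln (INR N))%R.
    { apply le_INR in H1. rewrite pow_INR in H1. change (INR 2) with 2%R in H1.
      apply ln_le in H1; [|apply pow_lt; lra]. rewrite ln_pow in H1 by lra.
      pose proof ln_lt_2. pose proof (pos_INR (Nat.log2 N)).
      assert (INR (Nat.log2 N) * / 2 <= INR (Nat.log2 N) * ln 2)%R by (apply Rmult_le_compat_l; lra).
      lra. }
    rewrite S_INR.
    assert (H3 : (1 + b * ln (INR N) <= rpow b N)%R) by (unfold rpow; apply exp_ineq1_le).
    assert (H4 : (4 / b * (b * ln (INR N)) = 4 * ln (INR N))%R) by (field; lra).
    assert (4 / b * (b * ln (INR N)) <= 4 / b * rpow b N)%R by (apply Rmult_le_compat_l; lra).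
    nra.
Qed.

(** Summation by parts. With x = n^b and y = (n+1)^b, the increment x (1/x^2 -
    1/y^2) is at most 2 (1/x - 1/y), so the total telescopes. *)
Lemma abel_bound (w : nat -> C) c b N : (0 < b)%R ->
  (forall n, (1 <= n)%nat -> (Cmod (csum w n) <= c * rpow b n)%R) ->
  (Cmod (csum (fun n => w n * RtoC (rpow (- (2 * b)) n))%C N) <= 2 * c)%R.
Proof.
  intros Hb HW.
  assert (Hc : (0 <= c)%R).
  { specialize (HW 1%nat ltac:(lia)). unfold rpow in HW. simpl in HW.
    rewrite ln_1, Rmult_0_r, exp_0 in HW. pose proof (Cmod_ge_0 (csum w 1)). lra. }
  destruct N as [|N]; [rewrite csum_0, Cmod_0; lra|].
  set (E := fun N => csum (fun n => w n * RtoC (rpow (- (2 * b)) n))%C N - csum w N * RtoC (rpow (- (2 * b)) N)).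
  assert (Hp : forall n, (0 < rpow b n)%R) by (intros; apply exp_pos).
  assert (Hv : forall n, rpow (- (2 * b)) n = (/ (rpow b n * rpow b n))%R).
  { intros n. unfold rpow. rewrite <- exp_plus, <- exp_Ropp. f_equal. ring. }
  assert (HE : (Cmod (E (S N)) <= 2 * c * (1 - / rpow b (S N)))%R).
  { induction N as [|N IH].
    - unfold E. rewrite !csum_S, !csum_0.
      replace (0 + w 1%nat * RtoC (rpow (- (2 * b)) 1) - (0 + w 1%nat) * RtoC (rpow (- (2 * b)) 1)) with (RtoC 0) by ring.
      rewrite Cmod_0. unfold rpow. simpl. rewrite ln_1, Rmult_0_r, exp_0, Rinv_1. lra.
    - replace (E (S (S N))) with (E (S N) + csum w (S N) * RtoC (rpow (- (2 * b)) (S N) - rpow (- (2 * b)) (S (S N)))).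
      2: { unfold E. rewrite !(csum_S _ (S N)), RtoC_minus. ring. }
      eapply Rle_trans; [apply Cmod_triangle|]. rewrite Cmod_mult, Cmod_R.
      specialize (HW (S N) ltac:(lia)).
      set (x := rpow b (S N)) in *. set (y := rpow b (S (S N))).
      assert (Hxy : (x <= y)%R).
      { unfold x, y, rpow. apply exp_le. apply Rmult_le_compat_l; [lra|].
        left. apply ln_INR_lt; lia. }
      rewrite !Hv. fold x y.
      assert (Hx : (0 < x)%R) by apply Hp. assert (Hy : (0 < y)%R) by apply Hp.
      assert (Hd : (0 <= / (x * x) - / (y * y))%R).
      { assert (/ (y * y) <= / (x * x))%R by (apply Rinv_le_contravar; nra). lra. }
      rewrite Rabs_right by lra.
      assert (Hk : (x * (/ (x * x) - / (y * y)) <= 2 * (/ x - / y))%R).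
      { (* the difference of the two sides is (y - x)^2 / (x y^2) *)
        assert (E1 : (2 * (/ x - / y) - x * (/ (x * x) - / (y * y)) = / x * (/ y * (y - x) * (/ y * (y - x))))%R)
          by (field; lra).
        assert (0 < / x)%R by (apply Rinv_0_lt_compat; auto).
        assert (0 <= / x * (/ y * (y - x) * (/ y * (y - x))))%R by (apply Rmult_le_pos; [lra|apply Rle_0_sqr]).
        lra. }
      assert (Cmod (csum w (S N)) * (/ (x * x) - / (y * y)) <= c * x * (/ (x * x) - / (y * y)))%R
        by (apply Rmult_le_compat_r; auto).
      assert (c * (x * (/ (x * x) - / (y * y))) <= c * (2 * (/ x - / y)))%R by (apply Rmult_le_compat_l; auto).
      lra. }
  pose proof (Cmod_le_add (csum (fun n => w n * RtoC (rpow (- (2 * b)) n))%C (S N)) (csum w (S N) * RtoC (rpow (- (2 * b)) (S N)))) as H.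
  fold (E (S N)) in H. rewrite Cmod_mult, Cmod_R, Hv, Rabs_right in H.
  2: { left. apply Rinv_0_lt_compat. pose proof (Hp (S N)). nra. }
  specialize (HW (S N) ltac:(lia)). pose proof (Hp (S N)) as Hx. set (x := rpow b (S N)) in *.
  assert (Hi : (0 < / x)%R) by (apply Rinv_0_lt_compat; auto).
  assert (H2 : (Cmod (csum w (S N)) * / (x * x) <= c * x * / (x * x))%R).
  { apply Rmult_le_compat_r; auto. left; apply Rinv_0_lt_compat; nra. }
  replace (c * x * / (x * x))%R with (c * / x)%R in H2 by (field; lra). nra.
Qed.

Lemma npow_cis n (x y : R) : npow n (x, y) = RtoC (exp (ln (INR n) * x)) * cis (ln (INR n) * y).
Proof.
  unfold npow, Cexp, cis, Cmult, RtoC; simpl. 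
  replace (ln (INR n) * x - 0 * y)%R with (ln (INR n) * x)%R by ring.
  replace (ln (INR n) * y + 0 * x)%R with (ln (INR n) * y)%R by ring.
  f_equal; ring.
Qed.

Lemma npow_R n (x : R) : npow n (RtoC x) = RtoC (exp (ln (INR n) * x)).
Proof.
  unfold RtoC at 1. rewrite npow_cis, Rmult_0_r. unfold cis. rewrite cos_0, sin_0.
  unfold RtoC, Cmult; simpl. f_equal; ring.
Qed.

Lemma dirichlet_csum (p : nat -> C) N s : dirichlet_partial p N s = csum (fun k => p k * npow k (- s))%C N.
Proof. reflexivity. Qed.

(** The factor N^(del/2) that truncation costs is absorbed by moving [del] to
    the right of the line on which the polynomial is bounded; the constant
    depends neither on the polynomial nor on [N]. *)
Lemma bohr_partial_bound del : (0 < del)%R -> exists c : R, (0 < c)%R /\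
  forall (p : nat -> C) K sig M, (forall n, (K < n)%nat -> p n = 0) ->
  (forall s, Re s = sig -> (Cmod (dirichlet_partial p K s) <= M)%R) ->
  forall N s, Re s = (sig + del)%R -> (Cmod (dirichlet_partial p N s) <= c * M)%R.
Proof.
  intros Hdel. set (b := (del / 2)%R). assert (Hb : (0 < b)%R) by (unfold b; lra).
  destruct (log_bound_rpow b Hb) as [c [Hc HJ]].
  exists (2 * c)%R. split; [lra|]. intros p K sig M Hp HM N s Hs.
  (* n^(-s) = n^(-s0) n^(-2b) with Re s0 = sig: truncation is bounded at s0 *)
  set (s0 := s - RtoC del). assert (Hs0 : Re s0 = sig).
  { unfold s0. destruct s; simpl in *. lra. }
  assert (HM0 : (0 <= M)%R) by (eapply Rle_trans; [apply Cmod_ge_0 | apply (HM s0 Hs0)]).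
  replace (2 * c * M)%R with (2 * (c * M))%R by ring.
  rewrite dirichlet_csum, (csum_ext _ (fun n => (p n * npow n (- s0)) * RtoC (rpow (- (2 * b)) n))).
  2: { intros n _. replace (- s) with (- s0 + RtoC (- del)).
       - rewrite npow_plus, npow_R. unfold rpow, b.
         replace (- (2 * (del / 2)) * ln (INR n))%R with (ln (INR n) * - del)%R by field. ring.
       - unfold s0. rewrite RtoC_opp. ring. }
  apply abel_bound; auto. intros n Hn.
  destruct (HJ n Hn) as [J [HJ1 HJ2]].
  eapply Rle_trans.
  - apply (truncation_log_bound _ n (Nat.max n K) M J Hn HJ1); [|lia]. intros t.
    specialize (HM (s0 - Ci * RtoC t)).
    assert (Hre : Re (s0 - Ci * RtoC t) = sig) by (destruct s0; simpl in *; lra).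
    specialize (HM Hre). rewrite dirichlet_csum in HM.
    rewrite (csum_trunc _ K (Nat.max n K)); [|lia|].
    + rewrite (csum_ext _ (fun k => p k * npow k (- (s0 - Ci * RtoC t)))); auto.
      intros k _. rewrite <- Cmult_assoc. f_equal.
      replace (- (s0 - Ci * RtoC t)) with (- s0 + ((0%R, t) : C)).
      * rewrite npow_plus, npow_cis, Rmult_0_r, exp_0. ring.
      * destruct s0. unfold Ci, RtoC, Cmult, Copp, Cplus, Cminus; simpl. f_equal; ring.
    + intros k Hk. rewrite Hp by lia. ring.
  - replace (c * M * rpow b n)%R with (c * rpow b n * M)%R by ring.
    apply Rmult_le_compat_r; auto.
Qed.

Lemma Cauchy_Clim (v : nat -> C) :
  (forall eps, (0 < eps)%R -> exists N0, forall i j, (N0 <= i)%nat -> (N0 <= j)%nat -> (Cmod (v i - v j) <= eps)%R) ->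
  exists l, Clim v l.
Proof.
  intros H.
  assert (Hr : Cauchy_crit (fun n => Re (v n))).
  { intros eps Heps. destruct (H (eps / 2)%R ltac:(lra)) as [N0 HN]. exists N0. intros i j Hi Hj.
    unfold Rdist. specialize (HN i j Hi Hj). pose proof (re_le_Cmod (v i - v j)) as H1.
    replace (Re (v i) - Re (v j))%R with (Re (v i - v j)) by (destruct (v i), (v j); simpl; ring). lra. }
  assert (Hi : Cauchy_crit (fun n => Im (v n))).
  { intros eps Heps. destruct (H (eps / 2)%R ltac:(lra)) as [N0 HN]. exists N0. intros i j Hi Hj.
    unfold Rdist. specialize (HN i j Hi Hj). pose proof (Im_le_Cmod (v i - v j)) as H1.
    replace (Im (v i) - Im (v j))%R with (Im (v i - v j)) by (destruct (v i), (v j); simpl; ring). lra. }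
  destruct (Rcomplete.R_complete _ Hr) as [x Hx]. destruct (Rcomplete.R_complete _ Hi) as [y Hy].
  exists (x, y). intros eps Heps.
  destruct (Hx (eps / 2)%R ltac:(lra)) as [N1 H1]. destruct (Hy (eps / 2)%R ltac:(lra)) as [N2 H2].
  exists (N1 + N2)%nat. intros N HN. specialize (H1 N ltac:(lia)). specialize (H2 N ltac:(lia)).
  unfold Rdist in *. eapply Rle_trans; [apply Cmod_le_Re_Im|]. destruct (v N); simpl in *.
  unfold Rminus in *. lra.
Qed.

Lemma Clim_csum (F : nat -> nat -> C) (G : nat -> C) N :
  (forall n, (1 <= n <= N)%nat -> Clim (fun j => F j n) (G n)) -> Clim (fun j => csum (F j) N) (csum G N).
Proof.
  induction N as [|N IH]; intros H.
  - apply Clim_ext with (fun _ => 0); [intros; now rewrite csum_0 | rewrite csum_0; apply Clim_const].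
  - rewrite csum_S. apply Clim_ext with (fun j => csum (F j) N + F j (S N)); [intros; now rewrite csum_S|].
    apply Clim_plus; [apply IH; intros; apply H; lia | apply H; lia].
Qed.

Definition dirichlet_poly (P : C -> C) : Prop :=
  exists (p : nat -> C) K, (forall n, (K < n)%nat -> p n = 0) /\ forall s, P s = dirichlet_partial p K s.

(** Approximation on each half-plane separately: the polynomial may depend on
    [eps], so a function approximable in this sense need not be bounded on the
    right half-plane. *)
Definition poly_approximable (f : C -> C) : Prop :=
  forall eps eta, (0 < eps)%R -> (0 < eta)%R ->
  exists P, dirichlet_poly P /\ forall s, half_plane eps s -> (Cmod (P s - f s) <= eta)%R.

Lemma dirichlet_partial_minus (p q : nat -> C) N s :
  dirichlet_partial (fun n => p n - q n) N s = dirichlet_partial p N s - dirichlet_partial q N s.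
Proof.
  rewrite !dirichlet_csum, <- csum_minus. apply csum_ext. intros. ring.
Qed.

Lemma dirichlet_partial_trunc (p : nat -> C) K N s : (forall n, (K < n)%nat -> p n = 0) -> (K <= N)%nat ->
  dirichlet_partial p N s = dirichlet_partial p K s.
Proof.
  intros H HN. rewrite !dirichlet_csum. apply csum_trunc; auto. intros n Hn. rewrite H by lia. ring.
Qed.

(** The coefficients of approximating polynomials converge, since a
    coefficient is a difference of two partial sums. By [bohr_partial_bound]
    the partial sums of the polynomials are Cauchy uniformly in the length of
    the sum, so the limit over the polynomials and the limit over the length
    can be exchanged. *)
Theorem bohr_completeness (f : C -> C) : poly_approximable f -> exists a, dirichlet_cv a f.
Proof.
  intros Hf.
  assert (Hch : forall j : nat, { pK : (nat -> C) * nat | (forall n, (snd pK < n)%nat -> fst pK n = 0) /\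
     forall s, half_plane (/ INR (S j)) s -> (Cmod (dirichlet_partial (fst pK) (snd pK) s - f s) <= / INR (S j))%R }).
  { intros j. apply constructive_indefinite_description.
    assert (0 < / INR (S j))%R by (apply Rinv_0_lt_compat, lt_0_INR; lia).
    destruct (Hf _ _ H H) as [P [[p [K [HK HP]]] Hap]]. exists (p, K). split; auto.
    intros s Hs. simpl. rewrite <- HP. auto. }
  set (p := fun j => fst (proj1_sig (Hch j))). set (K := fun j => snd (proj1_sig (Hch j))).
  assert (HpK : forall j n, (K j < n)%nat -> p j n = 0) by (intros j; apply (proj2_sig (Hch j))).
  assert (Hpf : forall eps eta, (0 < eps)%R -> (0 < eta)%R -> exists j0, forall j, (j0 <= j)%nat ->
     forall s, half_plane eps s -> (Cmod (dirichlet_partial (p j) (K j) s - f s) <= eta)%R).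
  { intros eps eta Heps Heta.
    assert (Hmin : (0 < Rmin eps eta)%R) by (apply Rmin_pos; auto).
    destruct (archimed_cor1 _ Hmin) as [j0 [Hj0 Hj0p]].
    exists j0. intros j Hj s Hs.
    assert (/ INR (S j) <= / INR j0)%R.
    { apply Rinv_le_contravar. apply lt_0_INR; auto. apply le_INR; lia. }
    pose proof (Rmin_l eps eta). pose proof (Rmin_r eps eta).
    eapply Rle_trans; [apply (proj2 (proj2_sig (Hch j)))|]. unfold half_plane in *; lra. lra. }
  clearbody p K. clear Hch Hf.
  assert (Hdiff : forall sig eta, (0 < sig)%R -> (0 < eta)%R -> exists j0, forall i j, (j0 <= i)%nat -> (j0 <= j)%nat ->
     forall N s, Re s = sig -> (Cmod (dirichlet_partial (fun n => p i n - p j n)%C N s) <= eta)%R).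
  { intros sig eta Hsig Heta.
    destruct (bohr_partial_bound (sig / 2) ltac:(lra)) as [c [Hc HB]].
    assert (He : (0 < eta / (2 * c))%R) by (apply Rdiv_lt_0_compat; lra).
    destruct (Hpf (sig / 4)%R (eta / (2 * c))%R ltac:(lra) He) as [j0 Hj0].
    exists j0. intros i j Hi Hj N s Hs.
    replace eta with (c * (eta / (2 * c) + eta / (2 * c)))%R by (field; lra).
    apply (HB _ (K i + K j)%nat (sig / 2)%R).
    - intros n Hn. rewrite !HpK by lia. ring.
    - intros s' Hs'. rewrite dirichlet_partial_minus.
      rewrite (dirichlet_partial_trunc (p i) (K i)), (dirichlet_partial_trunc (p j) (K j)); auto; try lia.
      eapply Rle_trans; [apply (Cmod_sub_rev _ (f s'))|].
      rewrite (Cmod_minus_sym (f s')). apply Rplus_le_compat; apply Hj0; auto; unfold half_plane; lra.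
    - rewrite Hs. field. }
  assert (Hcoef : forall n, exists l, (1 <= n)%nat -> Clim (fun j => p j n) l).
  { intros n. destruct (Nat.le_gt_cases 1 n) as [Hn|Hn]; [|exists 0; lia].
    destruct (Cauchy_Clim (fun j => p j n)) as [l Hl]; [|exists l; auto].
    intros eps Heps.
    set (e := exp (ln (INR n) * 1)). assert (He : (0 < e)%R) by apply exp_pos.
    assert (Hq : (0 < eps / (2 * e))%R) by (apply Rdiv_lt_0_compat; lra).
    destruct (Hdiff 1%R (eps / (2 * e))%R ltac:(lra) Hq) as [j0 Hj0].
    exists j0. intros i j Hi Hj. destruct n as [|n]; [lia|].
    pose proof (Hj0 i j Hi Hj (S n) (RtoC 1) eq_refl) as A. pose proof (Hj0 i j Hi Hj n (RtoC 1) eq_refl) as B.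
    rewrite !dirichlet_csum in A, B. rewrite csum_S in A.
    set (q := (p i (S n) - p j (S n)) * npow (S n) (- RtoC 1)) in *.
    assert (Hqq : (Cmod q <= eps / e)%R).
    { match type of A with (Cmod (?X + q) <= _)%R => set (X0 := X) in * end.
      replace q with ((X0 + q) + - X0) by ring. eapply Rle_trans; [apply Cmod_triangle|]. rewrite Cmod_opp.
      replace (eps / e)%R with (eps / (2 * e) + eps / (2 * e))%R by (field; lra). lra. }
    replace (p i (S n) - p j (S n)) with (q * npow (S n) (RtoC 1)).
    - rewrite Cmod_mult, Cmod_npow. change (Re (RtoC 1)) with 1%R. fold e.
      apply Rmult_le_compat_r with (r := e) in Hqq; [|lra].
      replace (eps / e * e)%R with eps in Hqq by (field; lra). exact Hqq.
    - unfold q. rewrite <- Cmult_assoc, (Cmult_comm (npow (S n) (- RtoC 1))), npow_opp. ring. }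
  set (a := fun n => proj1_sig (constructive_indefinite_description _ (Hcoef n))).
  assert (Ha : forall n, (1 <= n)%nat -> Clim (fun j => p j n) (a n)).
  { intros n. apply (proj2_sig (constructive_indefinite_description _ (Hcoef n))). }
  exists a. intros s Hs. apply filterlim_Clim. intros eps Heps. unfold half_plane in Hs.
  destruct (Hdiff (Re s) (eps / 2)%R Hs ltac:(lra)) as [j1 Hj1].
  destruct (Hpf (Re s / 2)%R (eps / 2)%R ltac:(lra) ltac:(lra)) as [j2 Hj2].
  set (j := (j1 + j2)%nat). exists (K j). intros N HN.
  eapply Rle_trans; [apply (Cmod_sub_rev _ (dirichlet_partial (p j) N s))|].
  assert (Cmod (dirichlet_partial (p j) N s - f s) <= eps / 2)%R.
  { rewrite (dirichlet_partial_trunc _ (K j)); auto. apply Hj2. unfold j; lia. unfold half_plane; lra. }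
  assert (Cmod (dirichlet_partial a N s - dirichlet_partial (p j) N s) <= eps / 2)%R.
  { rewrite <- dirichlet_partial_minus.
    apply (Clim_Cmod_le (fun i => dirichlet_partial (fun n => p (i + j1)%nat n - p j n)%C N s)).
    - intros i. apply Hj1; auto; unfold j; lia.
    - apply Clim_csum. intros n Hn. apply Clim_mult; [|apply Clim_const].
      unfold Cminus. apply Clim_plus; [|apply Clim_const].
      intros e He. destruct (Ha n ltac:(lia) e He) as [N0 HN0]. exists N0. intros i Hi. apply HN0. lia. }
  lra.
Qed.

(** * Holomorphy and closure properties of the function space *)

(** Explicit form of complex differentiability, used because the norm
    estimates for the exponential enter through it. *)
Definition Cderiv (f : C -> C) (s l : C) : Prop :=
  forall eps, (0 < eps)%R -> exists del, (0 < del)%R /\ forall y, (Cmod (y - s) < del)%R ->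
    (Cmod (f y - f s - (y - s) * l) <= eps * Cmod (y - s))%R.

Lemma ex_derive_Cderiv f s :
  @ex_derive C_AbsRing C_NormedModule f s <-> exists l, Cderiv f s l.
Proof.
  split.
  - intros [l [_ H]]. exists l. intros eps Heps.
    destruct (H s (fun P HP => HP) (mkposreal eps Heps)) as [[del Hdel] Hd].
    exists del. split; [exact Hdel | exact Hd].
  - intros [l H]. exists l. split; [apply is_linear_scal_l|].
    intros x Hx.
    assert (E : s = x) by (apply (@is_filter_lim_locally_unique C_AbsRing (AbsRing_NormedModule C_AbsRing)); exact Hx).
    subst x. intros [eps Heps]. destruct (H eps Heps) as [del [Hdel Hd]].
    exists (mkposreal del Hdel). intros y Hy. exact (Hd y Hy).
Qed.

Lemma Cderiv_scal k f s l : Cderiv f s l -> Cderiv (fun s => k * f s) s (k * l).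
Proof.
  intros H eps Heps. pose proof (Cmod_ge_0 k).
  destruct (H (eps / (1 + Cmod k))%R) as [del [Hdel Hd]]; [apply Rdiv_lt_0_compat; lra|].
  exists del. split; auto. intros y Hy.
  replace (k * f y - k * f s - (y - s) * (k * l)) with (k * (f y - f s - (y - s) * l)) by ring.
  rewrite Cmod_mult. specialize (Hd y Hy). pose proof (Cmod_ge_0 (y - s)) as Hys.
  apply Rle_trans with (Cmod k * (eps / (1 + Cmod k) * Cmod (y - s)))%R; [apply Rmult_le_compat_l; auto|].
  replace (Cmod k * (eps / (1 + Cmod k) * Cmod (y - s)))%R with ((Cmod k / (1 + Cmod k)) * (eps * Cmod (y - s)))%R by (field; lra).
  assert (Cmod k / (1 + Cmod k) <= 1)%R.
  { apply Rmult_le_reg_r with (1 + Cmod k)%R; [lra|].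
    replace (Cmod k / (1 + Cmod k) * (1 + Cmod k))%R with (Cmod k) by (field; lra). lra. }
  assert (0 <= eps * Cmod (y - s))%R by (apply Rmult_le_pos; lra). nra.
Qed.

Lemma Cderiv_id s : Cderiv (fun s => s) s 1.
Proof.
  intros eps Heps. exists 1%R. split; [lra|]. intros y _.
  replace (y - s - (y - s) * 1) with (RtoC 0) by ring. rewrite Cmod_0.
  apply Rmult_le_pos; [lra|apply Cmod_ge_0].
Qed.

Lemma Cderiv_plus f g s l m : Cderiv f s l -> Cderiv g s m -> Cderiv (fun s => f s + g s) s (l + m).
Proof.
  intros H1 H2 eps Heps.
  destruct (H1 (eps / 2)%R ltac:(lra)) as [d1 [Hd1 K1]].
  destruct (H2 (eps / 2)%R ltac:(lra)) as [d2 [Hd2 K2]].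
  exists (Rmin d1 d2). split; [apply Rmin_pos; auto|]. intros y Hy.
  pose proof (Rmin_l d1 d2). pose proof (Rmin_r d1 d2).
  specialize (K1 y ltac:(lra)). specialize (K2 y ltac:(lra)).
  replace (f y + g y - (f s + g s) - (y - s) * (l + m)) with
    ((f y - f s - (y - s) * l) + (g y - g s - (y - s) * m)) by ring.
  eapply Rle_trans; [apply Cmod_triangle|]. lra.
Qed.

Lemma Cderiv_exp w s l : Cderiv w s l -> Cderiv (fun s => Cexp (w s)) s (Cexp (w s) * l).
Proof.
  intros H eps Heps.
  pose proof (Cmod_ge_0 l) as Hl.
  set (E := Cmod (Cexp (w s))). assert (HE : (0 < E)%R) by (apply Cmod_gt_0, Cexp_neq_0).
  set (B := (1 + Cmod l)%R).
  destruct (H 1%R ltac:(lra)) as [d1 [Hd1 K1]].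
  assert (He2 : (0 < eps / (2 * E))%R) by (apply Rdiv_lt_0_compat; lra).
  destruct (H _ He2) as [d2 [Hd2 K2]].
  assert (Hd3 : (0 < / B)%R) by (apply Rinv_0_lt_compat; unfold B; lra).
  assert (Hd4 : (0 < eps / (2 * E) / (6 * (B * B)))%R) by (apply Rdiv_lt_0_compat; auto; unfold B; nra).
  exists (Rmin (Rmin d1 d2) (Rmin (/ B) (eps / (2 * E) / (6 * (B * B))))).
  split; [repeat apply Rmin_pos; auto|].
  intros y Hy. set (r := Cmod (y - s)) in *. assert (Hr : (0 <= r)%R) by apply Cmod_ge_0.
  assert (r < d1 /\ r < d2 /\ r < / B /\ r < eps / (2 * E) / (6 * (B * B)))%R as [R1 [R2 [R3 R4]]].
  { pose proof (Rmin_l (Rmin d1 d2) (Rmin (/ B) (eps / (2 * E) / (6 * (B * B))))).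
    pose proof (Rmin_r (Rmin d1 d2) (Rmin (/ B) (eps / (2 * E) / (6 * (B * B))))).
    pose proof (Rmin_l d1 d2). pose proof (Rmin_r d1 d2).
    pose proof (Rmin_l (/ B) (eps / (2 * E) / (6 * (B * B)))).
    pose proof (Rmin_r (/ B) (eps / (2 * E) / (6 * (B * B)))). lra. }
  specialize (K1 y R1). specialize (K2 y R2). fold r in K1, K2.
  set (h := w y - w s) in *.
  assert (Hh : (Cmod h <= B * r)%R).
  { pose proof (Cmod_le_add h ((y - s) * l)) as T. rewrite Cmod_mult in T. fold r in T. unfold B. lra. }
  assert (Hh1 : (Cmod h <= 1)%R).
  { assert (B * r <= B * / B)%R by (apply Rmult_le_compat_l; unfold B in *; lra).
    rewrite Rinv_r in H0 by (unfold B; lra). lra. }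
  pose proof (Cexp_quad h Hh1) as Q.
  replace (Cexp (w y) - Cexp (w s) - (y - s) * (Cexp (w s) * l)) with
    (Cexp (w s) * ((Cexp h - 1 - h) + (h - (y - s) * l))).
  2: { replace (w y) with (w s + h) by (unfold h; ring). rewrite Cexp_plus. ring. }
  rewrite Cmod_mult. fold E.
  assert (P1 : (Cmod (Cexp h - 1 - h) <= eps / (2 * E) * r)%R).
  { eapply Rle_trans; [exact Q|].
    assert (Cmod h * Cmod h <= (B * r) * (B * r))%R by (apply Rmult_le_compat; auto; apply Cmod_ge_0).
    assert (HB : (0 < 6 * (B * B))%R) by (unfold B; nra).
    assert (6 * (B * B) * r <= eps / (2 * E))%R.
    { replace (eps / (2 * E))%R with (6 * (B * B) * (eps / (2 * E) / (6 * (B * B))))%R by (field; unfold B; lra).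
      apply Rmult_le_compat_l; lra. }
    apply Rle_trans with ((6 * (B * B) * r) * r)%R; [lra|]. apply Rmult_le_compat_r; auto. }
  apply Rle_trans with (E * (eps / (2 * E) * r + eps / (2 * E) * r))%R.
  - apply Rmult_le_compat_l; [lra|]. eapply Rle_trans; [apply Cmod_triangle|]. lra.
  - right. field. lra.
Qed.

Lemma holomorphic_ext f g : eq_C0 f g -> holomorphic_C0 f -> holomorphic_C0 g.
Proof.
  intros E H s Hs. apply ex_derive_Cderiv. destruct (proj1 (ex_derive_Cderiv f s) (H s Hs)) as [l Hl].
  exists l. intros eps Heps. destruct (Hl eps Heps) as [del [Hdel Hd]].
  unfold half_plane in Hs.
  exists (Rmin del (Re s)). split; [apply Rmin_pos; auto|]. intros y Hy.
  pose proof (Rmin_l del (Re s)). pose proof (Rmin_r del (Re s)).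
  rewrite <- !E; auto. apply Hd; lra.
  unfold half_plane. pose proof (re_le_Cmod (y - s)) as T. apply Rabs_le_between in T.
  destruct y, s; simpl in *. lra.
Qed.

Lemma holomorphic_exp k f : holomorphic_C0 f -> holomorphic_C0 (fun s => Cexp (k * f s)).
Proof.
  intros H s Hs. apply ex_derive_Cderiv. specialize (H s Hs). apply ex_derive_Cderiv in H.
  destruct H as [l H]. eexists. apply (Cderiv_exp (fun s => k * f s)), Cderiv_scal, H.
Qed.

Lemma holomorphic_id : holomorphic_C0 (fun s => s).
Proof. intros s Hs. apply ex_derive_Cderiv. eexists; apply Cderiv_id. Qed.

Lemma holomorphic_plus f g : holomorphic_C0 f -> holomorphic_C0 g -> holomorphic_C0 (fun s => f s + g s).
Proof.
  intros H1 H2 s Hs. specialize (H1 s Hs). specialize (H2 s Hs).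
  apply ex_derive_Cderiv in H1. apply ex_derive_Cderiv in H2. apply ex_derive_Cderiv.
  destruct H1, H2. eexists. apply Cderiv_plus; eauto.
Qed.

Lemma holomorphic_scal k f : holomorphic_C0 f -> holomorphic_C0 (fun s => k * f s).
Proof.
  intros H s Hs. specialize (H s Hs). apply ex_derive_Cderiv in H. apply ex_derive_Cderiv.
  destruct H. eexists. apply Cderiv_scal; eauto.
Qed.

Lemma dirichlet_cv_Clim a f : dirichlet_cv a f <->
  (forall s, half_plane 0 s -> Clim (fun N => dirichlet_partial a N s) (f s)).
Proof.
  split; intros H s Hs; apply filterlim_Clim; auto. 
Qed.

Lemma Hinf_ext f g : eq_C0 f g -> Hinf_plus f -> Hinf_plus g.
Proof.
  intros E [H1 [H2 [a H3]]]. split; [eapply holomorphic_ext; eauto|split].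
  - intros eps Heps. destruct (H2 eps Heps) as [M HM]. exists M. intros s Hs. rewrite <- E; auto.
    unfold half_plane in *; lra.
  - exists a. intros s Hs. rewrite <- E; auto.
Qed.

Lemma dirichlet_cv_plus a b f g : dirichlet_cv a f -> dirichlet_cv b g ->
  dirichlet_cv (fun n => a n + b n) (fun s => f s + g s).
Proof.
  rewrite !dirichlet_cv_Clim. intros H1 H2 s Hs.
  apply Clim_ext with (fun N => dirichlet_partial a N s + dirichlet_partial b N s).
  - intros N. rewrite !dirichlet_csum, <- csum_plus. apply csum_ext. intros; ring.
  - apply Clim_plus; auto.
Qed.

Lemma dirichlet_cv_scal k a f : dirichlet_cv a f -> dirichlet_cv (fun n => k * a n) (fun s => k * f s).
Proof.
  rewrite !dirichlet_cv_Clim. intros H1 s Hs.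
  apply Clim_ext with (fun N => k * dirichlet_partial a N s).
  - intros N. rewrite !dirichlet_csum, <- csum_scal. apply csum_ext. intros; ring.
  - apply Clim_mult; auto. apply Clim_const.
Qed.

Lemma Hinf_add f g : Hinf_plus f -> Hinf_plus g -> Hinf_plus (fun s => f s + g s).
Proof.
  intros [F1 [F2 [a F3]]] [G1 [G2 [b G3]]]. split; [apply holomorphic_plus; auto|split].
  - intros eps Heps. destruct (F2 eps Heps) as [M1 H1]. destruct (G2 eps Heps) as [M2 H2].
    exists (M1 + M2)%R. intros s Hs. eapply Rle_trans; [apply Cmod_triangle|].
    specialize (H1 s Hs). specialize (H2 s Hs). lra.
  - eexists. apply dirichlet_cv_plus; eauto.
Qed.

Lemma Hinf_scal k f : Hinf_plus f -> Hinf_plus (fun s => k * f s).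
Proof.
  intros [F1 [F2 [a F3]]]. split; [apply holomorphic_scal; auto|split].
  - intros eps Heps. destruct (F2 eps Heps) as [M1 H1].
    exists (Cmod k * M1)%R. intros s Hs. rewrite Cmod_mult. apply Rmult_le_compat_l; auto. apply Cmod_ge_0.
  - eexists. apply dirichlet_cv_scal; eauto.
Qed.

Definition monomial (n : nat) : C -> C := fun s => npow n (- s).

Definition unit_coef (n k : nat) : C := if Nat.eqb k n then 1 else 0.

Lemma dirichlet_partial_unit n N s : (1 <= n <= N)%nat ->
  dirichlet_partial (unit_coef n) N s = npow n (- s).
Proof.
  intros Hn. rewrite dirichlet_csum, (csum_single _ n); auto.
  - unfold unit_coef. rewrite Nat.eqb_refl. ring.
  - intros k _ Hk. unfold unit_coef. apply Nat.eqb_neq in Hk. rewrite Hk. ring.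
Qed.

Lemma dirichlet_cv_monomial n : (1 <= n)%nat -> dirichlet_cv (unit_coef n) (monomial n).
Proof.
  intros Hn. apply dirichlet_cv_Clim. intros s Hs eps Heps. exists n. intros N HN.
  rewrite dirichlet_partial_unit by lia. unfold monomial, Cminus. rewrite Cplus_opp_r, Cmod_0. lra.
Qed.

Lemma Hinf_monomial n : (1 <= n)%nat -> Hinf_plus (monomial n).
Proof.
  intros Hn. split; [|split].
  - apply holomorphic_ext with (fun s => Cexp (- RtoC (ln (INR n)) * s)).
    + intros s _. unfold monomial, npow. f_equal. ring.
    + apply (holomorphic_exp _ (fun s => s)), holomorphic_id.
  - intros eps Heps. exists 1%R. intros s Hs. apply Cmod_npow_le_1; auto. unfold half_plane in Hs. lra.
  - exists (unit_coef n). apply dirichlet_cv_monomial; auto.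
Qed.

Lemma Hinf_const k : Hinf_plus (fun _ => k).
Proof.
  apply Hinf_ext with (fun s => k * monomial 1 s).
  - intros s _. unfold monomial. rewrite npow_1. ring.
  - apply Hinf_scal, Hinf_monomial. lia.
Qed.

Lemma lin_comb_csum n a e s : lin_comb n a e s = csum (fun i => a i * e i s)%C n.
Proof. reflexivity. Qed.

Lemma Hinf_lin_comb n a e : (forall i, (1 <= i <= n)%nat -> Hinf_plus (e i)) -> Hinf_plus (lin_comb n a e).
Proof.
  induction n as [|n IH]; intros H.
  - apply Hinf_ext with (fun _ => 0); [|apply Hinf_const]. intros s _. rewrite lin_comb_csum, csum_0. auto.
  - apply Hinf_ext with (fun s => lin_comb n a e s + a (S n) * e (S n) s).
    + intros s _. rewrite !lin_comb_csum, csum_S. auto.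
    + apply Hinf_add; [apply IH; intros; apply H; lia|]. apply Hinf_scal, H. lia.
Qed.

(** * The power m^(-u) of a Koenigs map *)

Lemma dirichlet_poly_ext P Q : (forall s, P s = Q s) -> dirichlet_poly P -> dirichlet_poly Q.
Proof. intros E [p [K [H1 H2]]]. exists p, K. split; auto. intros; rewrite <- E; auto. Qed.

Lemma dirichlet_poly_partial (c : nat -> C) N : dirichlet_poly (dirichlet_partial c N).
Proof.
  exists (fun n => if Nat.leb n N then c n else 0), N. split.
  - intros n Hn. apply Nat.leb_gt in Hn. rewrite Hn. auto.
  - intros s. apply csum_ext. intros n Hn. assert (L : Nat.leb n N = true) by (apply Nat.leb_le; lia).
    rewrite L. auto.
Qed.

Lemma dirichlet_poly_monomial n : (1 <= n)%nat -> dirichlet_poly (monomial n).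
Proof.
  intros Hn. apply dirichlet_poly_ext with (dirichlet_partial (unit_coef n) n).
  - intros s. apply dirichlet_partial_unit. lia.
  - apply dirichlet_poly_partial.
Qed.

Lemma dirichlet_poly_plus P Q : dirichlet_poly P -> dirichlet_poly Q -> dirichlet_poly (fun s => P s + Q s).
Proof.
  intros [p [K [H1 H2]]] [q [L [H3 H4]]]. exists (fun n => p n + q n), (K + L)%nat. split.
  - intros n Hn. rewrite H1, H3 by lia. ring.
  - intros s. rewrite H2, H4, <- (dirichlet_partial_trunc p K (K + L)), <- (dirichlet_partial_trunc q L (K + L)); auto; try lia.
    rewrite !dirichlet_csum, <- csum_plus. apply csum_ext. intros; ring.
Qed.

Lemma dirichlet_poly_scal k P : dirichlet_poly P -> dirichlet_poly (fun s => k * P s).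
Proof.
  intros [p [K [H1 H2]]]. exists (fun n => k * p n), K. split.
  - intros n Hn. rewrite H1 by lia. ring.
  - intros s. rewrite H2, !dirichlet_csum, <- csum_scal. apply csum_ext. intros; ring.
Qed.

Lemma dirichlet_poly_const k : dirichlet_poly (fun _ => k).
Proof.
  apply dirichlet_poly_ext with (fun s => k * monomial 1 s).
  - intros s. unfold monomial. rewrite npow_1. ring.
  - apply dirichlet_poly_scal, dirichlet_poly_monomial. lia.
Qed.

Lemma dirichlet_poly_monomial_mult n Q : (1 <= n)%nat -> dirichlet_poly Q ->
  dirichlet_poly (fun s => monomial n s * Q s).
Proof.
  intros Hn [q [L [_ HQ]]].
  apply dirichlet_poly_ext with (fun s => monomial n s * dirichlet_partial q L s).
  { intros s. rewrite HQ. auto. }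
  clear HQ. induction L as [|L IH].
  - apply dirichlet_poly_ext with (fun _ => 0); [|apply dirichlet_poly_const].
    intros s. rewrite dirichlet_csum, csum_0. ring.
  - apply dirichlet_poly_ext with (fun s => monomial n s * dirichlet_partial q L s + q (S L) * monomial (n * S L) s).
    + intros s. rewrite !dirichlet_csum, csum_S. unfold monomial. rewrite npow_mult by lia. ring.
    + apply dirichlet_poly_plus; auto. apply dirichlet_poly_scal, dirichlet_poly_monomial. nia.
Qed.

Lemma dirichlet_poly_mult P Q : dirichlet_poly P -> dirichlet_poly Q -> dirichlet_poly (fun s => P s * Q s).
Proof.
  intros [p [K [_ HP]]] HQ.
  apply dirichlet_poly_ext with (fun s => dirichlet_partial p K s * Q s).
  { intros s. rewrite HP. auto. }
  clear HP. induction K as [|K IH].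
  - apply dirichlet_poly_ext with (fun _ => 0); [|apply dirichlet_poly_const].
    intros s. rewrite dirichlet_csum, csum_0. ring.
  - apply dirichlet_poly_ext with (fun s => dirichlet_partial p K s * Q s + p (S K) * (monomial (S K) s * Q s)).
    + intros s. rewrite !dirichlet_csum, csum_S. unfold monomial. ring.
    + apply dirichlet_poly_plus; auto. apply dirichlet_poly_scal, dirichlet_poly_monomial_mult; auto. lia.
Qed.

Lemma dirichlet_poly_pow P n : dirichlet_poly P -> dirichlet_poly (fun s => Cpow (P s) n).
Proof.
  intros HP. induction n as [|n IH].
  - apply (dirichlet_poly_const 1).
  - apply (dirichlet_poly_mult P _ HP IH).
Qed.

Lemma Cpow_diff_bound A B E n : (1 <= E)%R -> (Cmod A <= E)%R -> (Cmod B <= E)%R ->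
  (Cmod (Cpow A n - Cpow B n) <= INR n * E ^ n * Cmod (A - B))%R.
Proof.
  intros HE HA HB. induction n as [|n IH].
  - simpl. replace (RtoC 1 - RtoC 1) with (RtoC 0) by ring. rewrite Cmod_0. lra.
  - replace (Cpow A (S n) - Cpow B (S n)) with (A * (Cpow A n - Cpow B n) + (A - B) * Cpow B n) by (simpl; ring).
    eapply Rle_trans; [apply Cmod_triangle|]. rewrite !Cmod_mult, Cmod_pow, S_INR.
    pose proof (Cmod_ge_0 A). pose proof (Cmod_ge_0 B). pose proof (Cmod_ge_0 (A - B)) as Hd.
    assert (HEn : (0 <= E ^ n)%R) by (apply pow_le; lra).
    assert (P1 : (Cmod B ^ n <= E ^ n)%R) by (apply pow_incr; lra).
    assert (P2 : (E ^ n <= E ^ S n)%R) by (simpl; nra).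
    assert (T1 : (Cmod A * Cmod (Cpow A n - Cpow B n) <= E * (INR n * E ^ n * Cmod (A - B)))%R).
    { apply Rmult_le_compat; auto. apply Cmod_ge_0. }
    assert (T2 : (Cmod (A - B) * Cmod B ^ n <= Cmod (A - B) * E ^ S n)%R) by (apply Rmult_le_compat_l; lra).
    simpl pow in *. lra.
Qed.

Lemma exp_INR_mult n x : (exp x ^ n = exp (INR n * x))%R.
Proof.
  induction n as [|n IH].
  - simpl. rewrite Rmult_0_l, exp_0. auto.
  - rewrite S_INR. simpl. rewrite IH, <- exp_plus. f_equal. ring.
Qed.

Lemma Cexp_INR_mult n z : Cpow (Cexp z) n = Cexp (RtoC (INR n) * z).
Proof.
  induction n as [|n IH].
  - simpl. rewrite Cmult_0_l, Cexp_0. auto.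
  - rewrite S_INR, RtoC_plus. simpl. rewrite IH, <- Cexp_plus. f_equal. ring.
Qed.

(** Compare [1 + w/n] with [exp (w/n)]: they differ by O(1/n^2), and raising
    to the power [n] multiplies the error by at most n exp R. This turns the
    exponential of a Dirichlet polynomial into a limit of Dirichlet
    polynomials. *)
Lemma Cexp_power_approx R w n : (0 <= R)%R -> (Cmod w <= R)%R -> (1 <= n)%nat -> (R <= INR n)%R ->
  (Cmod (Cpow (1 + RtoC (/ INR n) * w) n - Cexp w) <= 6 * (R * R) * exp R / INR n)%R.
Proof.
  intros HR Hw Hn HnR. pose proof (INR_ge_1 n Hn) as Hn1.
  set (v := RtoC (/ INR n) * w).
  assert (Hi : (0 < / INR n)%R) by (apply Rinv_0_lt_compat; lra).
  assert (Hv : (Cmod v <= / INR n * R)%R).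
  { unfold v. rewrite Cmod_scal_R, Rabs_right by lra. apply Rmult_le_compat_l; lra. }
  assert (Hw' : Cexp w = Cpow (Cexp v) n).
  { rewrite Cexp_INR_mult. f_equal. unfold v. rewrite Cmult_assoc, <- RtoC_mult, Rinv_r by lra. ring. }
  set (x := (/ INR n * R)%R) in *.
  assert (Hx : (0 <= x)%R) by (unfold x; apply Rmult_le_pos; lra).
  assert (Hx1 : (x <= 1)%R).
  { unfold x. apply Rle_trans with (/ INR n * INR n)%R; [apply Rmult_le_compat_l; lra|].
    rewrite Rinv_l; lra. }
  rewrite Hw'. eapply Rle_trans; [apply (Cpow_diff_bound _ _ (exp x))|].
  - rewrite <- exp_0. apply exp_le; auto.
  - eapply Rle_trans; [apply Cmod_triangle|]. rewrite Cmod_1. pose proof (exp_ineq1_le x). lra.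
  - rewrite Cmod_Cexp. apply exp_le. pose proof (re_le_Cmod v). pose proof (Rle_abs (Re v)). lra.
  - rewrite exp_INR_mult. replace (INR n * x)%R with R by (unfold x; field; lra).
    assert (Cmod (1 + v - Cexp v) <= 6 * (x * x))%R.
    { replace (1 + v - Cexp v) with (- (Cexp v - 1 - v)) by ring. rewrite Cmod_opp.
      pose proof (Cmod_ge_0 v).
      eapply Rle_trans; [apply Cexp_quad; lra|]. apply Rmult_le_compat_l; [lra|]. apply Rmult_le_compat; auto. }
    apply Rle_trans with (INR n * exp R * (6 * (x * x)))%R.
    + apply Rmult_le_compat_l; auto. apply Rmult_le_pos; [lra|left; apply exp_pos].
    + right. unfold x. field. lra.
Qed.

Lemma dirichlet_unif_bounded d theta : dirichlet_unif_cv d theta ->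
  forall eps, (0 < eps)%R -> exists R, (0 <= R)%R /\ forall s, half_plane eps s -> (Cmod (theta s) <= R)%R.
Proof.
  intros H eps Heps. destruct (H eps Heps 1%R ltac:(lra)) as [N HN].
  specialize (HN N (Nat.le_refl _)).
  exists (1 + rsum (fun n => Cmod (d n))%R N)%R. split.
  - assert (0 <= rsum (fun n => Cmod (d n))%R N)%R; [|lra].
    clear. induction N as [|N IH]; [rewrite rsum_0; lra|]. rewrite rsum_S. pose proof (Cmod_ge_0 (d (S N))). lra.
  - intros s Hs. specialize (HN s Hs). rewrite Cmod_minus_sym in HN.
    pose proof (Cmod_le_add (theta s) (dirichlet_partial d N s)) as T.
    assert (Cmod (dirichlet_partial d N s) <= rsum (fun n => Cmod (d n))%R N)%R; [|lra].
    rewrite dirichlet_csum. eapply Rle_trans; [apply Cmod_csum_le|]. apply rsum_le. intros n Hn.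
    rewrite Cmod_mult. pose proof (Cmod_ge_0 (d n)).
    assert (Cmod (npow n (- s)) <= 1)%R by (apply Cmod_npow_le_1; unfold half_plane in Hs; [lia|lra]). nra.
Qed.

(** A uniformly convergent Dirichlet series is bounded on each half-plane, so
    its exponential is uniformly close to that of a partial sum, which in turn
    is uniformly close to a Dirichlet polynomial. *)
Lemma poly_approximable_exp k d theta m : (1 <= m)%nat -> dirichlet_unif_cv d theta ->
  poly_approximable (fun s => monomial m s * Cexp (k * theta s)).
Proof.
  intros Hm H eps eta Heps Heta.
  destruct (dirichlet_unif_bounded d theta H eps Heps) as [R0 [HR0 HB]].
  pose proof (Cmod_ge_0 k) as Hk.
  set (R := (Cmod k * (R0 + 1))%R). assert (HR : (0 <= R)%R) by (apply Rmult_le_pos; lra).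
  pose proof (exp_pos R) as HeR.
  (* eta/2 bounds the error of replacing theta by a partial sum within del, and
     eta/2 that of Euler's power with exponent n *)
  set (del := Rmin 1 (Rmin (/ (1 + Cmod k)) (eta / 2 / (7 * exp R * (1 + Cmod k))))).
  assert (Hdel : (0 < del)%R).
  { repeat apply Rmin_pos; [lra|apply Rinv_0_lt_compat; lra|apply Rdiv_lt_0_compat; [lra|]].
    apply Rmult_lt_0_compat; lra. }
  destruct (H eps Heps del Hdel) as [N HN]. specialize (HN N (Nat.le_refl _)).
  destruct (nfloor_ex (R + 6 * (R * R) * exp R / (eta / 2))) as [n0 [_ Hn0]].
  { assert (0 <= 6 * (R * R) * exp R / (eta / 2))%R; [|lra].
    apply Rmult_le_pos; [|left; apply Rinv_0_lt_compat; lra].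
    apply Rmult_le_pos; [|lra]. nra. }
  set (n := S n0). assert (Hn : (1 <= n)%nat) by (unfold n; lia).
  assert (HnR : (R + 6 * (R * R) * exp R / (eta / 2) < INR n)%R) by (unfold n; rewrite S_INR; auto).
  exists (fun s => monomial m s * Cpow (1 + RtoC (/ INR n) * (k * dirichlet_partial d N s)) n).
  split.
  { apply (dirichlet_poly_mult (monomial m)); [apply dirichlet_poly_monomial; auto|].
    apply (dirichlet_poly_pow (fun s => 1 + RtoC (/ INR n) * (k * dirichlet_partial d N s))).
    apply (dirichlet_poly_plus (fun _ => 1)); [apply dirichlet_poly_const|].
    apply (dirichlet_poly_scal _ (fun s => k * dirichlet_partial d N s)), dirichlet_poly_scal, dirichlet_poly_partial. }
  intros s Hs. specialize (HN s Hs). specialize (HB s Hs).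
  set (t := theta s) in *. set (p := dirichlet_partial d N s) in *.
  assert (D1 : (del <= 1)%R) by apply Rmin_l.
  assert (D2 : (del <= / (1 + Cmod k))%R) by (eapply Rle_trans; [apply Rmin_r|apply Rmin_l]).
  assert (D3 : (del <= eta / 2 / (7 * exp R * (1 + Cmod k)))%R) by (eapply Rle_trans; [apply Rmin_r|apply Rmin_r]).
  assert (Hp : (Cmod (k * p) <= R)%R).
  { rewrite Cmod_mult. apply Rmult_le_compat_l; auto. pose proof (Cmod_le_add p t). lra. }
  assert (Ht : (Cmod (k * t) <= R)%R).
  { rewrite Cmod_mult. apply Rmult_le_compat_l; auto. lra. }
  assert (A1 : (Cmod (Cpow (1 + RtoC (/ INR n) * (k * p)) n - Cexp (k * p)) <= eta / 2)%R).
  { assert (HX : (0 <= 6 * (R * R) * exp R)%R) by (apply Rmult_le_pos; [|lra]; nra).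
    assert (HX2 : (0 <= 6 * (R * R) * exp R / (eta / 2))%R).
    { apply Rmult_le_pos; auto. left; apply Rinv_0_lt_compat; lra. }
    eapply Rle_trans; [apply (Cexp_power_approx R); auto; lra|].
    set (X := (6 * (R * R) * exp R)%R) in *.
    assert (Hnp : (0 < INR n)%R) by (apply lt_0_INR; lia).
    apply Rmult_le_reg_r with (INR n); auto. unfold Rdiv at 1. rewrite Rmult_assoc, Rinv_l, Rmult_1_r by lra.
    assert (X / (eta / 2) * (eta / 2) <= INR n * (eta / 2))%R by (apply Rmult_le_compat_r; lra).
    replace (X / (eta / 2) * (eta / 2))%R with X in H0 by (field; lra). lra. }
  assert (A2 : (Cmod (Cexp (k * p) - Cexp (k * t)) <= eta / 2)%R).
  { replace (k * p) with (k * t + k * (p - t)) by ring. rewrite Cexp_plus.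
    replace (Cexp (k * t) * Cexp (k * (p - t)) - Cexp (k * t)) with (Cexp (k * t) * (Cexp (k * (p - t)) - 1)) by ring.
    rewrite Cmod_mult.
    assert (Hq : (Cmod (k * (p - t)) <= (1 + Cmod k) * del)%R).
    { rewrite Cmod_mult. apply Rmult_le_compat; auto; try apply Cmod_ge_0; lra. }
    assert (Hq1 : ((1 + Cmod k) * del <= 1)%R).
    { apply Rle_trans with ((1 + Cmod k) * / (1 + Cmod k))%R; [apply Rmult_le_compat_l; lra|].
      rewrite Rinv_r; lra. }
    pose proof (Cexp_lip (k * (p - t)) ltac:(lra)) as Q.
    assert (He : (Cmod (Cexp (k * t)) <= exp R)%R).
    { rewrite Cmod_Cexp. apply exp_le. pose proof (re_le_Cmod (k * t)). pose proof (Rle_abs (Re (k * t))). lra. }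
    apply Rle_trans with (exp R * (7 * ((1 + Cmod k) * (eta / 2 / (7 * exp R * (1 + Cmod k))))))%R.
    - apply Rmult_le_compat; auto; try apply Cmod_ge_0.
      eapply Rle_trans; [exact Q|]. apply Rmult_le_compat_l; [lra|].
      eapply Rle_trans; [exact Hq|]. apply Rmult_le_compat_l; lra.
    - right. field. lra. }
  replace (monomial m s * Cpow (1 + RtoC (/ INR n) * (k * p)) n - monomial m s * Cexp (k * t))
    with (monomial m s * (Cpow (1 + RtoC (/ INR n) * (k * p)) n - Cexp (k * t))) by ring.
  rewrite Cmod_mult.
  assert (Cmod (monomial m s) <= 1)%R by (apply Cmod_npow_le_1; unfold half_plane in Hs; [lia|lra]).
  pose proof (Cmod_sub_rev (Cpow (1 + RtoC (/ INR n) * (k * p)) n) (Cexp (k * p)) (Cexp (k * t))).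
  pose proof (Cmod_ge_0 (Cpow (1 + RtoC (/ INR n) * (k * p)) n - Cexp (k * t))). 
  pose proof (Cmod_ge_0 (monomial m s)). nra.
Qed.

(** Writing u(s) = s + theta(s), the function m^(-u) is m^(-s) times the
    exponential of a multiple of theta; that it has a convergent Dirichlet
    series is where Bohr's theorem is needed. *)
Lemma Hinf_koenigs_power u m : (1 <= m)%nat -> GH_pos 1 u -> Hinf_plus (fun s => npow m (- u s)).
Proof.
  intros Hm [_ [Hol [d [theta [Hu Hd]]]]].
  assert (E : eq_C0 (fun s => monomial m s * Cexp (- RtoC (ln (INR m)) * theta s)) (fun s => npow m (- u s))).
  { intros s Hs. rewrite (Hu s Hs). unfold monomial, npow. rewrite <- Cexp_plus. f_equal. simpl. ring. }
  split; [|split].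
  - apply holomorphic_ext with (fun s => Cexp (- RtoC (ln (INR m)) * u s)).
    + intros s _. unfold npow. f_equal. ring.
    + apply holomorphic_exp; auto.
  - intros eps Heps. destruct (dirichlet_unif_bounded d theta Hd eps Heps) as [R [HR HB]].
    exists (exp (ln (INR m) * R)). intros s Hs. rewrite <- E by (unfold half_plane in *; lra).
    rewrite Cmod_mult, Cmod_Cexp.
    assert (Cmod (monomial m s) <= 1)%R by (apply Cmod_npow_le_1; unfold half_plane in Hs; [lia|lra]).
    assert (exp (Re (- RtoC (ln (INR m)) * theta s)) <= exp (ln (INR m) * R))%R.
    { apply exp_le. pose proof (ln_INR_ge_0 m Hm).
      specialize (HB s Hs). pose proof (re_le_Cmod (theta s)) as T. apply Rabs_le_between in T.
      destruct (theta s) as [x y]. simpl in *. nra. }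
    pose proof (exp_pos (Re (- RtoC (ln (INR m)) * theta s))). pose proof (Cmod_ge_0 (monomial m s)). nra.
  - destruct (bohr_completeness _ (poly_approximable_exp (- RtoC (ln (INR m))) d theta m Hm Hd)) as [a Ha].
    exists a. intros s Hs. rewrite <- E; auto.
Qed.

(** * Behaviour of a Dirichlet series far to the right *)

Lemma Clim_bounded v l : Clim v l -> exists B, forall n, (Cmod (v n) <= B)%R.
Proof.
  intros H. destruct (H 1%R ltac:(lra)) as [N0 HN].
  assert (F : forall N, exists B, forall n, (n < N)%nat -> (Cmod (v n) <= B)%R).
  { induction N as [|N [B HB]]; [exists 0%R; lia|].
    exists (Rmax B (Cmod (v N))). intros n Hn. destruct (Nat.eq_dec n N) as [->|].
    - apply Rmax_r.
    - eapply Rle_trans; [apply HB; lia|apply Rmax_l]. }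
  destruct (F N0) as [B HB]. exists (Rmax B (1 + Cmod l)). intros n.
  destruct (Nat.lt_ge_cases n N0) as [Hn|Hn].
  - eapply Rle_trans; [apply HB; auto|apply Rmax_l].
  - eapply Rle_trans; [|apply Rmax_r]. specialize (HN n Hn). pose proof (Cmod_le_add (v n) l). lra.
Qed.

(** The terms of the series at the point [sig] are differences of bounded
    partial sums. *)
Lemma dirichlet_coef_bound a f sig : dirichlet_cv a f -> (0 < sig)%R ->
  exists A, (0 <= A)%R /\ forall n, (1 <= n)%nat -> (Cmod (a n) <= A * exp (sig * ln (INR n)))%R.
Proof.
  intros H Hs. assert (Hp : half_plane 0 (RtoC sig)) by exact Hs.
  destruct (Clim_bounded _ _ (proj1 (dirichlet_cv_Clim a f) H _ Hp)) as [B HB].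
  exists (2 * B)%R. split.
  { specialize (HB 0%nat). pose proof (Cmod_ge_0 (dirichlet_partial a 0 (RtoC sig))). lra. }
  intros [|n] Hn; [lia|]. pose proof (HB (S n)) as H1. pose proof (HB n) as H2.
  rewrite dirichlet_csum in H1, H2. rewrite csum_S in H1.
  assert (HT : (Cmod (a (S n) * npow (S n) (- RtoC sig)) <= 2 * B)%R).
  { set (X := csum _ n) in *. replace (a (S n) * npow (S n) (- RtoC sig)) with
      ((X + a (S n) * npow (S n) (- RtoC sig)) + - X) by ring.
    eapply Rle_trans; [apply Cmod_triangle|]. rewrite Cmod_opp. lra. }
  replace (a (S n)) with ((a (S n) * npow (S n) (- RtoC sig)) * npow (S n) (RtoC sig)).
  - rewrite Cmod_mult, (Cmod_npow _ (RtoC sig)). change (Re (RtoC sig)) with sig. rewrite (Rmult_comm (ln _)).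
    apply Rmult_le_compat_r; auto. left; apply exp_pos.
  - rewrite <- Cmult_assoc, (Cmult_comm (npow (S n) (- RtoC sig))), npow_opp. ring.
Qed.

(** From |a_n| <= A n one gets |a_n n^(-s)| <= A (m+1)^(3 - Re s) n^(-2) for n
    > m and Re s >= 3, and the sum of n^(-2) is bounded by a telescoping one. *)
Lemma dirichlet_leading_bound a f m : dirichlet_cv a f -> (1 <= m)%nat ->
  (forall n, (1 <= n < m)%nat -> a n = 0) ->
  exists K, (0 <= K)%R /\ forall s, (3 <= Re s)%R ->
    (Cmod (f s - a m * npow m (- s)) <= K * exp (- (Re s * ln (INR (S m)))))%R.
Proof.
  intros H Hm Hz. destruct (dirichlet_coef_bound a f 1 H ltac:(lra)) as [A [HA HB]].
  exists (A * exp (3 * ln (INR (S m))))%R. split.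
  { apply Rmult_le_pos; auto. left; apply exp_pos. }
  intros s Hs. set (E := exp ((3 - Re s) * ln (INR (S m)))).
  assert (HE : (0 < E)%R) by apply exp_pos.
  replace (A * exp (3 * ln (INR (S m))) * exp (- (Re s * ln (INR (S m)))))%R with (A * E)%R.
  2: { unfold E. rewrite Rmult_assoc, <- exp_plus. f_equal. f_equal. ring. }
  assert (P : forall N, (m <= N)%nat ->
    (Cmod (dirichlet_partial a N s - a m * npow m (- s)) <= A * E * (1 - / INR N))%R).
  { intros N HN. induction HN as [|N HN IH].
    - rewrite dirichlet_csum, (csum_single _ m); [|lia|].
      + unfold Cminus. rewrite Cplus_opp_r, Cmod_0. apply Rmult_le_pos; [apply Rmult_le_pos; lra|].
        pose proof (INR_ge_1 m Hm). assert (/ INR m <= / 1)%R by (apply Rinv_le_contravar; lra).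
        rewrite Rinv_1 in H1. lra.
      + intros n Hn Hnm. rewrite Hz by lia. ring.
    - rewrite dirichlet_csum, csum_S.
      replace (csum (fun k => a k * npow k (- s))%C N + a (S N) * npow (S N) (- s) - a m * npow m (- s))
        with ((dirichlet_partial a N s - a m * npow m (- s)) + a (S N) * npow (S N) (- s))
        by (rewrite dirichlet_csum; ring).
      eapply Rle_trans; [apply Cmod_triangle|]. rewrite Cmod_mult, Cmod_npow.
      assert (HN1 : (1 <= INR N)%R) by (apply INR_ge_1; lia).
      assert (HlN : (ln (INR (S m)) <= ln (INR (S N)))%R).
      { apply ln_le; [apply lt_0_INR; lia|apply le_INR; lia]. }
      set (L := ln (INR (S N))) in *.
      assert (HeL : (exp L = INR (S N))%R) by (apply exp_ln, lt_0_INR; lia).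
      assert (T : (Cmod (a (S N)) * exp (L * Re (- s)) <= A * E * (/ INR N - / INR (S N)))%R).
      { apply Rle_trans with (A * exp (1 * L) * exp (L * Re (- s)))%R.
        - apply Rmult_le_compat_r; [left; apply exp_pos|]. apply HB; lia.
        - replace (A * exp (1 * L) * exp (L * Re (- s)))%R with (A * (exp ((3 - Re s) * L) * exp (- (L + L))))%R.
          2: { rewrite Rmult_assoc, <- !exp_plus. f_equal. f_equal. destruct s; simpl; ring. }
          rewrite (Rmult_assoc A E). apply Rmult_le_compat_l; auto.
          apply Rmult_le_compat; try (left; apply exp_pos).
          + unfold E. apply exp_le. nra.
          + rewrite exp_Ropp, exp_plus, HeL, S_INR.
            assert (0 < / (INR N * (INR N + 1)))%R by (apply Rinv_0_lt_compat; nra).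
            replace (/ INR N - / (INR N + 1))%R with (/ (INR N * (INR N + 1)))%R by (field; lra).
            apply Rinv_le_contravar; nra. }
      replace (A * E * (1 - / INR (S N)))%R with (A * E * (1 - / INR N) + A * E * (/ INR N - / INR (S N)))%R by ring.
      lra. }
  assert (Hp : half_plane 0 s) by (unfold half_plane; lra).
  apply (Clim_Cmod_le (fun N => dirichlet_partial a (N + m)%nat s - a m * npow m (- s))).
  - intros N. eapply Rle_trans; [apply P; lia|].
    assert (0 < / INR (N + m))%R by (apply Rinv_0_lt_compat, lt_0_INR; lia).
    assert (0 <= A * E)%R by (apply Rmult_le_pos; lra). nra.
  - apply Clim_plus; [|apply Clim_const]. intros eps Heps.
    destruct (proj1 (dirichlet_cv_Clim a f) H s Hp eps Heps) as [N0 HN]. exists N0. intros N HNN. apply HN. lia.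
Qed.

Lemma exp_decay g K eps : (0 < g)%R -> (0 <= K)%R -> (0 < eps)%R ->
  exists B, forall x, (B <= x)%R -> (K * exp (- (g * x)) <= eps)%R.
Proof.
  intros Hg HK He. exists (K / (g * eps))%R. intros x Hx.
  assert (0 < g * eps)%R by nra.
  assert (HK2 : (K <= eps * (g * x))%R).
  { apply Rmult_le_compat_r with (r := (g * eps)%R) in Hx; [|lra].
    replace (K / (g * eps) * (g * eps))%R with K in Hx by (field; lra). lra. }
  pose proof (exp_ineq1_le (g * x)). pose proof (exp_pos (- (g * x))).
  assert (exp (g * x) * exp (- (g * x)) = 1)%R.
  { rewrite <- exp_plus. replace (g * x + - (g * x))%R with 0%R by ring. apply exp_0. }
  apply Rle_trans with (eps * (exp (g * x) * exp (- (g * x))))%R; [|rewrite H2; lra].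
  rewrite <- Rmult_assoc. apply Rmult_le_compat_r; nra.
Qed.

Definition Re_to_infty (s : nat -> C) : Prop :=
  forall B, exists J, forall j, (J <= j)%nat -> (B <= Re (s j))%R.

(** Far to the right a Dirichlet series behaves like its first nonzero term;
    the two sides of an eigenvalue equation are compared through this limit. *)
Lemma dirichlet_leading_limit a f m s : dirichlet_cv a f -> (1 <= m)%nat ->
  (forall n, (1 <= n < m)%nat -> a n = 0) -> Re_to_infty s ->
  Clim (fun j => npow m (s j) * f (s j)) (a m).
Proof.
  intros H Hm Hz Hs eps Heps.
  destruct (dirichlet_leading_bound a f m H Hm Hz) as [K [HK HB]].
  pose proof (ln_INR_lt m (S m) Hm ltac:(lia)) as Hl.
  destruct (exp_decay (ln (INR (S m)) - ln (INR m)) K eps ltac:(lra) HK Heps) as [B HD].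
  destruct (Hs (Rmax B 3)) as [J HJ]. exists J. intros j Hj. specialize (HJ j Hj).
  pose proof (Rmax_l B 3). pose proof (Rmax_r B 3).
  replace (npow m (s j) * f (s j) - a m) with (npow m (s j) * (f (s j) - a m * npow m (- s j))).
  2: { transitivity (npow m (s j) * f (s j) - a m * (npow m (s j) * npow m (- s j))); [ring|].
       rewrite npow_opp. ring. }
  rewrite Cmod_mult, Cmod_npow. specialize (HB (s j) ltac:(lra)). specialize (HD (Re (s j)) ltac:(lra)).
  eapply Rle_trans; [apply Rmult_le_compat_l; [left; apply exp_pos|exact HB]|].
  eapply Rle_trans; [|exact HD]. right.
  replace (- ((ln (INR (S m)) - ln (INR m)) * Re (s j)))%R with (ln (INR m) * Re (s j) + - (Re (s j) * ln (INR (S m))))%R by ring.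
  rewrite exp_plus. ring.
Qed.

Definition real_points (j : nat) : C := RtoC (INR j + 1).

Lemma real_points_infty : Re_to_infty real_points.
Proof.
  intros B. destruct (nfloor_ex (Rmax 0 B)) as [n [_ Hn]]; [apply Rmax_l|].
  exists n. intros j Hj. apply le_INR in Hj. pose proof (Rmax_r 0 B). unfold real_points; simpl. lra.
Qed.

Lemma real_points_C0 j : half_plane 0 (real_points j).
Proof. unfold half_plane, real_points; simpl. pose proof (pos_INR j). lra. Qed.

Lemma strong_ind_from_1 (P : nat -> Prop) :
  (forall m, (1 <= m)%nat -> (forall n, (1 <= n < m)%nat -> P n) -> P m) -> forall m, (1 <= m)%nat -> P m.
Proof.
  intros H m. induction m as [m IH] using (well_founded_induction PeanoNat.Nat.lt_wf_0). intros Hm.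
  apply H; auto. intros n Hn. apply IH; lia.
Qed.

Lemma dirichlet_unique_zero a f : dirichlet_cv a f -> eq_C0 f (fun _ => RtoC 0) ->
  forall n, (1 <= n)%nat -> a n = 0.
Proof.
  intros H E. apply strong_ind_from_1. intros m Hm IH.
  apply (Clim_unique _ _ _ (dirichlet_leading_limit a f m real_points H Hm IH real_points_infty)).
  apply Clim_ext with (fun _ => 0); [|apply Clim_const].
  intros j. rewrite E by apply real_points_C0. ring.
Qed.

Lemma dirichlet_cv_zero a f : dirichlet_cv a f -> (forall n, (1 <= n)%nat -> a n = 0) ->
  eq_C0 f (fun _ => RtoC 0).
Proof.
  intros H Hz s Hs. apply (Clim_unique _ _ _ (proj1 (dirichlet_cv_Clim a f) H s Hs)).
  apply Clim_ext with (fun _ => 0); [|apply Clim_const].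
  intros N. rewrite dirichlet_csum, csum_zero; auto. intros n Hn. rewrite Hz by lia. ring.
Qed.

Lemma leading_index a f : dirichlet_cv a f -> ~ eq_C0 f (fun _ => RtoC 0) ->
  exists m, (1 <= m)%nat /\ a m <> 0 /\ forall n, (1 <= n < m)%nat -> a n = 0.
Proof.
  intros H Hn. apply NNPP. intros Hex. apply Hn. apply (dirichlet_cv_zero a f H).
  apply strong_ind_from_1. intros m Hm IH. apply NNPP. intros Ha. apply Hex. exists m. auto.
Qed.

Lemma Cexp_Clim v l : Clim v l -> Clim (fun j => Cexp (v j)) (Cexp l).
Proof.
  intros H eps Heps. set (E := Cmod (Cexp l)). assert (HE : (0 < E)%R) by (apply Cmod_gt_0, Cexp_neq_0).
  assert (Hd : (0 < Rmin 1 (eps / (7 * E)))%R) by (apply Rmin_pos; [lra|apply Rdiv_lt_0_compat; lra]).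
  destruct (H _ Hd) as [N0 HN]. exists N0. intros N HNN. specialize (HN N HNN).
  pose proof (Rmin_l 1 (eps / (7 * E))). pose proof (Rmin_r 1 (eps / (7 * E))).
  replace (v N) with (l + (v N - l)) by ring. rewrite Cexp_plus.
  replace (Cexp l * Cexp (v N - l) - Cexp l) with (Cexp l * (Cexp (v N - l) - 1)) by ring.
  rewrite Cmod_mult. fold E. pose proof (Cexp_lip (v N - l) ltac:(lra)).
  apply Rle_trans with (E * (7 * (eps / (7 * E))))%R; [apply Rmult_le_compat_l; lra|]. right. field. lra.
Qed.

Lemma dirichlet_unif_cv_cv c psi : dirichlet_unif_cv c psi -> dirichlet_cv c psi.
Proof.
  intros H. apply dirichlet_cv_Clim. intros s Hs eps Heps. unfold half_plane in Hs.
  destruct (H (Re s / 2)%R ltac:(lra) eps Heps) as [N0 HN]. exists N0. intros N HNN.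
  left. apply HN; auto. unfold half_plane; lra.
Qed.

Lemma dirichlet_limit_infty c psi s : dirichlet_cv c psi -> Re_to_infty s ->
  Clim (fun j => psi (s j)) (c 1%nat).
Proof.
  intros H Hs.
  apply Clim_ext with (fun j => npow 1 (s j) * psi (s j)).
  - intros j. rewrite npow_1. ring.
  - apply dirichlet_leading_limit; auto. intros; lia.
Qed.

(** Compare the leading terms of f(phi(s)) and lambda f(s). As m^phi f(phi)
    and m^s f(s) have the same nonzero limit [a m], lambda is the limit of
    m^(s - phi(s)). When c0 = 1 this is m^(-c_1), and for m = 1 it is 1. When
    c0 > 1 and m >= 2 it is 0, which would make f(phi) vanish and contradict
    [a m <> 0]. *)
Lemma eigen_leading c0 c phi psi f a lambda m :
  (1 <= c0)%nat -> eq_C0 phi (fun s => RtoC (INR c0) * s + psi s) -> dirichlet_cv c psi ->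
  dirichlet_cv a f -> eq_C0 (comp_op phi f) (fun s => lambda * f s) ->
  (1 <= m)%nat -> a m <> 0 -> (forall n, (1 <= n < m)%nat -> a n = 0) ->
  (c0 = 1%nat -> lambda = npow m (- c 1%nat)) /\
  ((1 < c0)%nat -> m = 1%nat /\ lambda = 1).
Proof.
  intros Hc0 Hphi Hpsi Hf Heig Hm Ham Hz.
  pose proof (dirichlet_limit_infty c psi _ Hpsi real_points_infty) as Lpsi.
  destruct (Clim_bounded _ _ Lpsi) as [B HB].
  pose proof (INR_ge_1 c0 Hc0) as Hc0R.
  assert (Hinf : Re_to_infty (fun j => phi (real_points j))).
  { intros b. destruct (real_points_infty (b + B)%R) as [J HJ]. exists J. intros j Hj. specialize (HJ j Hj).
    rewrite Hphi by apply real_points_C0. specialize (HB j). pose proof (re_le_Cmod (psi (real_points j))) as T.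
    apply Rabs_le_between in T. pose proof (real_points_C0 j) as P. unfold half_plane in P.
    unfold real_points in *; simpl in *. destruct (psi _); simpl in *. nra. }
  pose proof (dirichlet_leading_limit a f m _ Hf Hm Hz Hinf) as LX.
  pose proof (dirichlet_leading_limit a f m _ Hf Hm Hz real_points_infty) as LY.
  assert (Hid : forall j, npow m (real_points j - phi (real_points j)) * (npow m (phi (real_points j)) * f (phi (real_points j)))
     = lambda * (npow m (real_points j) * f (real_points j))).
  { intros j. pose proof (Heig _ (real_points_C0 j)) as E. unfold comp_op in E. rewrite E.
    rewrite Cmult_assoc, <- npow_plus.
    replace (real_points j - phi (real_points j) + phi (real_points j)) with (real_points j) by ring. ring. }
  assert (LR : Clim (fun j => npow m (real_points j - phi (real_points j)) * (npow m (phi (real_points j)) * f (phi (real_points j)))) (lambda * a m)).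
  { eapply Clim_ext; [intros j; symmetry; apply Hid|]. apply Clim_mult; auto. apply Clim_const. }
  split.
  - intros ->.
    assert (LZ : Clim (fun j => npow m (real_points j - phi (real_points j))) (npow m (- c 1%nat))).
    { apply Clim_ext with (fun j => Cexp (- RtoC (ln (INR m)) * psi (real_points j))).
      - intros j. rewrite Hphi by apply real_points_C0. unfold npow. f_equal. simpl. ring.
      - replace (npow m (- c 1%nat)) with (Cexp (- RtoC (ln (INR m)) * c 1%nat)) by (unfold npow; f_equal; ring).
        apply Cexp_Clim. apply Clim_mult; auto. apply Clim_const. }
    pose proof (Clim_unique _ _ _ LR (Clim_mult _ _ _ _ LZ LX)) as E.
    apply (f_equal (fun z => z / a m)) in E.
    replace (lambda * a m / a m) with lambda in E by (field; auto). rewrite E. field. auto.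
  - intros Hc1. destruct (Nat.eq_dec m 1) as [->|Hm1].
    + split; auto.
      assert (LZ : Clim (fun j => npow 1 (real_points j - phi (real_points j))) 1).
      { apply Clim_ext with (fun _ => 1); [intros; now rewrite npow_1|apply Clim_const]. }
      pose proof (Clim_unique _ _ _ LR (Clim_mult _ _ _ _ LZ LX)) as E.
      apply (f_equal (fun z => z / a 1%nat)) in E.
      replace (lambda * a 1%nat / a 1%nat) with lambda in E by (field; auto). rewrite E. field. auto.
    + exfalso.
      assert (LZ : Clim (fun j => npow m (real_points j - phi (real_points j))) 0).
      { assert (Hl : (0 < ln (INR m))%R).
        { rewrite <- ln_1. apply ln_increasing; [lra|]. apply (lt_INR 1); lia. }
        intros eps Heps.
        destruct (exp_decay (ln (INR m)) (exp (ln (INR m) * B)) eps Hl ltac:(left; apply exp_pos) Heps) as [b Hb].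
        destruct (real_points_infty b) as [J HJ]. exists J. intros j Hj. specialize (HJ j Hj).
        unfold Cminus. rewrite Copp_0, Cplus_0_r. rewrite Cmod_npow.
        eapply Rle_trans; [|apply (Hb _ HJ)]. rewrite <- exp_plus. apply exp_le.
        replace (ln (INR m) * B + - (ln (INR m) * Re (real_points j)))%R with (ln (INR m) * (B - Re (real_points j)))%R by ring.
        apply Rmult_le_compat_l; [lra|].
        rewrite Hphi by apply real_points_C0. specialize (HB j). pose proof (re_le_Cmod (psi (real_points j))) as T.
        apply Rabs_le_between in T. pose proof (real_points_C0 j) as P. unfold half_plane in P.
        assert (2 <= INR c0)%R by (apply (le_INR 2) in Hc1; simpl in Hc1; lra).
        unfold real_points in *; simpl in *. destruct (psi _); simpl in *. nra. }
      pose proof (Clim_unique _ _ _ LR (Clim_mult _ _ _ _ LZ LX)) as E.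
      rewrite Cmult_0_l in E.
      assert (lambda = 0).
      { apply (f_equal (fun z => z / a m)) in E.
        replace (lambda * a m / a m) with lambda in E by (field; auto). rewrite E. field. auto. }
      subst lambda. apply Ham.
      apply (Clim_unique _ _ _ LX). apply Clim_ext with (fun _ => 0); [|apply Clim_const].
      intros j. pose proof (Heig _ (real_points_C0 j)) as E2. unfold comp_op in E2. rewrite E2. ring.
Qed.

(** * Composition operators that are not translations *)

Lemma unimodular_cis (w : C) : Cmod w = 1%R -> exists t, w = cis t.
Proof.
  destruct w as [x y]. intros H.
  assert (Hxy : (x * x + y * y = 1)%R).
  { pose proof (Cmod2_alt (x, y)) as E. rewrite H in E. simpl in E. lra. }
  assert (Hx : (-1 <= x <= 1)%R) by (split; nra).
  destruct (Rle_dec 0 y) as [Hy|Hy].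
  - exists (acos x). unfold cis. rewrite cos_acos, sin_acos by auto. f_equal.
    replace (1 - x²)%R with (y * y)%R by (unfold Rsqr; lra). symmetry. apply sqrt_square; auto.
  - exists (- acos x)%R. unfold cis. rewrite cos_neg, sin_neg, cos_acos, sin_acos by auto. f_equal.
    replace (1 - x²)%R with ((- y) * (- y))%R by (unfold Rsqr; lra). rewrite sqrt_square; lra.
Qed.

Lemma G_pos_self_map c0 c phi s : G_pos c0 c phi -> half_plane 0 s -> half_plane 0 (phi s).
Proof.
  intros [Hc0 [psi [Hphi [_ Hpsi]]]] Hs. unfold half_plane in *. rewrite Hphi by exact Hs.
  assert (0 <= Re (psi s))%R.
  { destruct Hpsi as [[tau Ht]|Ht].
    - rewrite Ht by exact Hs. simpl. lra.
    - specialize (Ht s Hs). unfold half_plane in Ht. lra. }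
  apply INR_ge_1 in Hc0. destruct s, (psi _); simpl in *. nra.
Qed.

Lemma dirichlet_cv_minus_monomial a f k m : (1 <= m)%nat -> dirichlet_cv a f ->
  dirichlet_cv (fun n => a n + - k * unit_coef m n) (fun s => f s + - k * monomial m s).
Proof.
  intros Hm H. apply dirichlet_cv_plus; auto.
  apply (dirichlet_cv_scal (- k) (unit_coef m) (monomial m)), dirichlet_cv_monomial; auto.
Qed.

(** If Re c_1 <= 0, the next nonzero term of psi, of index m >= 2, decides the
    sign of Re psi - Re c_1 far to the right; on a suitable horizontal line
    that term is negative, so psi leaves the right half-plane. If there is no
    such term, psi is the constant c_1 and Re c_1 > 0 directly. *)
Lemma Re_first_coef_pos c phi : G_pos 1 c phi ->
  ~ (exists tau : R, eq_C0 phi (fun s => s + Ci * RtoC tau)) -> (0 < Re (c 1%nat))%R.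
Proof.
  intros [_ [psi [Hphi [Hunif Hpsi]]]] Hn. destruct Hpsi as [[tau Ht]|Hpos].
  { exfalso. apply Hn. exists tau. intros s Hs. rewrite Hphi, Ht by auto. simpl. ring. }
  apply dirichlet_unif_cv_cv in Hunif. apply Rnot_le_lt. intros Hle.
  pose proof (dirichlet_cv_minus_monomial c psi (c 1%nat) 1 ltac:(lia) Hunif) as Hd.
  destruct (leading_index _ _ Hd) as [m [Hm [Ham Hz]]].
  { intros E. pose proof (E _ (real_points_C0 0)) as E0. pose proof (Hpos _ (real_points_C0 0)) as P.
    unfold monomial in E0. rewrite npow_1 in E0.
    assert (psi (real_points 0) = c 1%nat).
    { replace (psi (real_points 0)) with (psi (real_points 0) + - c 1%nat * 1 + c 1%nat) by ring. rewrite E0. ring. }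
    rewrite H in P. unfold half_plane in P. lra. }
  assert (Hm2 : (2 <= m)%nat).
  { destruct (Nat.eq_dec m 1) as [->|]; [|lia]. exfalso. apply Ham. unfold unit_coef. simpl. ring. }
  destruct (dirichlet_leading_bound _ _ m Hd Hm Hz) as [K [HK HB]].
  set (b := c m + - c 1%nat * unit_coef 1 m) in *.
  assert (Hb : (0 < Cmod b)%R) by (apply Cmod_gt_0; auto).
  destruct (Cmod_unimodular_Re b) as [w [Hw1 Hw]].
  (* at Im s = - al / ln m the term b m^(-s) is a negative real *)
  destruct (unimodular_cis (- w)) as [al Hal]; [rewrite Cmod_opp; auto|].
  assert (Hl : (0 < ln (INR m))%R).
  { rewrite <- ln_1. apply ln_increasing; [lra|]. apply (lt_INR 1); lia. }
  pose proof (ln_INR_lt m (S m) Hm ltac:(lia)) as Hl2.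
  destruct (exp_decay (ln (INR (S m)) - ln (INR m)) K (Cmod b / 2) ltac:(lra) HK ltac:(lra)) as [B HD].
  set (x := Rmax 3 B). assert (Hx3 : (3 <= x)%R) by apply Rmax_l. specialize (HD x (Rmax_r _ _)).
  set (s := ((x, - (al / ln (INR m)))%R : C)).
  assert (Hs : half_plane 0 s) by (unfold half_plane, s; simpl; lra).
  specialize (HB s Hx3). specialize (Hpos s Hs).
  unfold monomial at 1 in HB. rewrite npow_1 in HB.
  assert (E1 : b * npow m (- s) = RtoC (- (Cmod b * exp (- (ln (INR m) * x))))).
  { replace (- s) with ((- x, al / ln (INR m))%R : C).
    - rewrite npow_cis. replace (ln (INR m) * (al / ln (INR m)))%R with al by (field; lra).
      rewrite <- Hal. replace (b * (RtoC (exp (ln (INR m) * - x)) * - w)) with (- (w * b) * RtoC (exp (ln (INR m) * - x))) by ring.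
      rewrite Hw. rewrite RtoC_opp, RtoC_mult. replace (ln (INR m) * - x)%R with (- (ln (INR m) * x))%R by ring. ring.
    - unfold s, Copp; simpl. f_equal. ring. }
  rewrite E1 in HB. change (Re s) with x in HB.
  assert (T : (K * exp (- (x * ln (INR (S m)))) <= Cmod b / 2 * exp (- (ln (INR m) * x)))%R).
  { replace (- (x * ln (INR (S m))))%R with (- ((ln (INR (S m)) - ln (INR m)) * x) + - (ln (INR m) * x))%R by ring.
    rewrite exp_plus, <- Rmult_assoc. apply Rmult_le_compat_r; auto. left; apply exp_pos. }
  pose proof (exp_pos (- (ln (INR m) * x))) as Hep. set (e := exp (- (ln (INR m) * x))) in *.
  pose proof (re_le_Cmod (psi s + - c 1%nat * 1 - RtoC (- (Cmod b * e)))) as Q. apply Rabs_le_between in Q.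
  unfold half_plane in Hpos.
  destruct (psi s), (c 1%nat); simpl in *. nra.
Qed.

Lemma span_single (g f : C -> C) : span (fun h => h = g) f <-> exists k, eq_C0 f (fun s => k * g s).
Proof.
  split.
  - intros [n [a [e [He Hf]]]]. exists (csum a n). intros s Hs. rewrite (Hf s Hs), lin_comb_csum.
    rewrite (csum_ext _ (fun i => g s * a i)%C).
    + rewrite csum_scal. ring.
    + intros i Hi. rewrite (He i Hi). ring.
  - intros [k Hk]. exists 1%nat, (fun _ => k), (fun _ => g). split; auto.
    intros s Hs. rewrite (Hk s Hs), lin_comb_csum, csum_S, csum_0. ring.
Qed.

Lemma has_dimension_single (V : (C -> C) -> Prop) (g : C -> C) :
  (exists s, half_plane 0 s /\ g s <> 0) ->
  (forall f, V f <-> exists k, eq_C0 f (fun s => k * g s)) -> has_dimension V 1.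
Proof.
  intros [s [Hs Hg]] HV. exists (fun _ => g). split.
  - intros a Ha i Hi. replace i with 1%nat by lia. specialize (Ha s Hs).
    rewrite lin_comb_csum, csum_S, csum_0 in Ha.
    destruct (Ceq_dec (a 1%nat) 0) as [|Hn]; auto. exfalso.
    apply (Cmult_neq_0 _ _ Hn Hg). rewrite <- Ha. ring.
  - intros f. rewrite HV, <- span_single. split; intros [n [a [e [He Hf]]]]; exists n, a, e; split; auto.
    + intros i Hi. exists 1%nat. split; auto.
    + intros i Hi. destruct (He i Hi) as [j [_ Hj]]. auto.
Qed.

Lemma one_C0 : half_plane 0 (RtoC 1).
Proof. unfold half_plane; simpl; lra. Qed.

(** [eigen_leading] forces the leading index of an eigenvector to be 1.
    Applied to f - a_1, whose leading index is at least 2, it shows that an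
    invariant f is constant. *)
Theorem characteristic_gt_one_case c0 c phi : G_pos c0 c phi -> (1 < c0)%nat ->
    (forall lambda : C, point_spectrum phi lambda <-> lambda = RtoC 1) /\
    (forall f : C -> C, Hinf_plus f ->
       (eq_C0 (comp_op phi f) f <-> exists a : C, eq_C0 f (fun _ => a))).
Proof.
  intros HG Hc. pose proof HG as [Hc1 [psi [Hphi [Hunif _]]]]. apply dirichlet_unif_cv_cv in Hunif.
  split.
  - intros lambda. split.
    + intros [f [[[_ [_ [a Ha]]] He] Hn]]. destruct (leading_index a f Ha Hn) as [m [Hm [Ham Hz]]].
      apply (eigen_leading c0 c phi psi f a lambda m Hc1 Hphi Hunif Ha He Hm Ham Hz); auto.
    + intros ->. exists (fun _ => 1). split; [split|].
      * apply Hinf_const.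
      * intros s _. unfold comp_op. ring.
      * intros E. specialize (E _ one_C0). simpl in E. apply RtoC_inj in E. lra.
  - intros f [_ [_ [a Ha]]]. split.
    + intros He. exists (a 1%nat). apply NNPP. intros Hn.
      pose proof (dirichlet_cv_minus_monomial a f (a 1%nat) 1 ltac:(lia) Ha) as Hd.
      destruct (leading_index _ _ Hd) as [m [Hm [Ham Hz]]].
      { intros E. apply Hn. intros s Hs. specialize (E s Hs). unfold monomial in E. rewrite npow_1 in E.
        replace (f s) with (f s + - a 1%nat * 1 + a 1%nat) by ring. rewrite E. ring. }
      edestruct (eigen_leading c0 c phi psi _ _ 1 m Hc1 Hphi Hunif Hd) as [_ H]; auto.
      * intros s Hs. unfold comp_op, monomial. rewrite !npow_1. specialize (He s Hs). unfold comp_op in He.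
        rewrite He. ring.
      * destruct (H Hc) as [-> _]. apply Ham. unfold unit_coef; simpl. ring.
    + intros [k Hk] s Hs. unfold comp_op. rewrite !Hk; auto. eapply G_pos_self_map; eauto.
Qed.

Lemma npow_opp_inj c m n : (0 < Re c)%R -> (1 <= m)%nat -> (1 <= n)%nat ->
  npow m (- c) = npow n (- c) -> m = n.
Proof.
  intros Hc Hm Hn E. apply (f_equal Cmod) in E. rewrite !Cmod_npow in E. apply exp_inv in E.
  apply INR_eq, ln_inv; try (apply lt_0_INR; lia). destruct c; simpl in *. nra.
Qed.

(** Since Re c_1 > 0, the moduli of the numbers m^(-c_1) are distinct, so an
    eigenvalue determines the leading index m. Subtracting from an eigenvector
    the multiple of m^(-u) with the same m-th coefficient leaves an
    eigenvector whose leading index cannot be m, hence zero. *)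
Theorem characteristic_one_case c phi u : G_pos 1 c phi -> koenigs_map 1 c phi u ->
   ~ (exists tau : R, eq_C0 phi (fun s => s + Ci * RtoC tau)) ->
    (forall lambda : C, point_spectrum phi lambda <->
       exists m : nat, (1 <= m)%nat /\ lambda = npow m (- c 1%nat)) /\
    (forall m : nat, (1 <= m)%nat ->
       has_dimension (eigenspace phi (npow m (- c 1%nat))) 1 /\
       (forall f : C -> C, eigenspace phi (npow m (- c 1%nat)) f <->
          span (fun g => g = (fun s => npow m (- u s))) f)).
Proof.
  intros HG [HGH [Hu _]] Hnt. pose proof (Re_first_coef_pos c phi HG Hnt) as Hc1.
  pose proof HG as [Hc0 [psi [Hphi [Hunif _]]]]. apply dirichlet_unif_cv_cv in Hunif.
  specialize (Hu eq_refl).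
  assert (Hlead : forall f a lambda m, dirichlet_cv a f -> eq_C0 (comp_op phi f) (fun s => lambda * f s) ->
    (1 <= m)%nat -> a m <> 0 -> (forall n, (1 <= n < m)%nat -> a n = 0) -> lambda = npow m (- c 1%nat)).
  { intros f a lambda m Ha He Hm Ham Hz.
    apply (eigen_leading 1 c phi psi f a lambda m Hc0 Hphi Hunif Ha He Hm Ham Hz); auto. }
  assert (Hg : forall m, (1 <= m)%nat -> eigenspace phi (npow m (- c 1%nat)) (fun s => npow m (- u s))).
  { intros m Hm. split; [apply Hinf_koenigs_power; auto|].
    intros s Hs. unfold comp_op. rewrite (Hu s Hs), <- npow_plus. f_equal. ring. }
  assert (Hone : forall m, (1 <= m)%nat -> forall f, eigenspace phi (npow m (- c 1%nat)) f <->
     exists k, eq_C0 f (fun s => k * npow m (- u s))).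
  { intros m Hm f. destruct (Hg m Hm) as [Gi Ge]. split.
    - intros [[_ [_ [a Ha]]] Fe]. pose proof Gi as [_ [_ [b Hb]]].
      destruct (leading_index b _ Hb) as [m' [Hm' [Hbm Hz]]].
      { intros E. apply (npow_neq_0 m (- u (RtoC 1))). apply (E _ one_C0). }
      pose proof (Hlead _ b _ m' Hb Ge Hm' Hbm Hz) as E. apply npow_opp_inj in E; auto. subst m'.
      exists (a m / b m). apply NNPP. intros Hn.
      pose proof (dirichlet_cv_plus _ _ _ _ Ha (dirichlet_cv_scal (- (a m / b m)) _ _ Hb)) as Hd.
      destruct (leading_index _ _ Hd) as [m' [Hm'' [Hdm Hz']]].
      { intros E. apply Hn. intros s Hs. specialize (E s Hs). cbv beta in E.
        replace (f s) with (f s + - (a m / b m) * npow m (- u s) + a m / b m * npow m (- u s)) by ring.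
        rewrite E. ring. }
      assert (E : npow m (- c 1%nat) = npow m' (- c 1%nat)).
      { apply (Hlead _ _ _ m' Hd); auto. intros s Hs. specialize (Fe s Hs). specialize (Ge s Hs).
        unfold comp_op in *. rewrite Fe, Ge. ring. }
      apply npow_opp_inj in E; auto. subst m'. apply Hdm. field. auto.
    - intros [k Hk]. split.
      + apply Hinf_ext with (fun s => k * npow m (- u s)); [intros s Hs; symmetry; auto|]. apply Hinf_scal; auto.
      + intros s Hs. specialize (Ge s Hs). unfold comp_op in *.
        rewrite (Hk s Hs), (Hk (phi s)), Ge; [ring|]. eapply G_pos_self_map; eauto. }
  split.
  - intros lambda. split.
    + intros [f [[[_ [_ [a Ha]]] He] Hn]]. destruct (leading_index a f Ha Hn) as [m [Hm [Ham Hz]]].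
      exists m. split; auto. eapply Hlead; eauto.
    + intros [m [Hm ->]]. exists (fun s => npow m (- u s)). split; auto.
      intros E. apply (npow_neq_0 m (- u (RtoC 1))). apply (E _ one_C0).
  - intros m Hm. split.
    + apply has_dimension_single with (fun s => npow m (- u s)); [|apply Hone; auto].
      exists (RtoC 1). split; [apply one_C0|apply npow_neq_0].
    + intros f. rewrite span_single. apply Hone; auto.
Qed.

(** * Vertical translations *)

Lemma dirichlet_partial_S (a : nat -> C) N s :
  dirichlet_partial a (S N) s = dirichlet_partial a N s + a (S N) * npow (S N) (- s).
Proof. apply csum_S. Qed.

(** Induction on the length of the block, with the lower bound [y] for the
    logarithms of its support as a parameter: the first support point
    contributes exp (-b y), and the remaining ones start at y + rho, so the
    geometric series of ratio exp (-b rho) sums the block. *)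
Lemma lacunary_block (a : nat -> C) (L : nat -> Prop) A b rho s :
  (0 < b)%R -> (0 < rho)%R -> (0 <= A)%R ->
  (forall n, (1 <= n)%nat -> ~ L n -> a n = 0) ->
  (forall n n', (1 <= n)%nat -> L n -> L n' -> (n < n')%nat -> (ln (INR n) + rho <= ln (INR n'))%R) ->
  (forall n, (1 <= n)%nat -> (Cmod (a n * npow n (- s)) <= A * exp (- (b * ln (INR n))))%R) ->
  forall k M y, (forall n, (M < n)%nat -> L n -> (y <= ln (INR n))%R) ->
  (Cmod (dirichlet_partial a (M + k) s - dirichlet_partial a M s)
     <= A * (/ (1 - exp (- (b * rho))) * exp (- (b * y))))%R.
Proof.
  intros Hb Hr HA Hz Hsep Hterm.
  assert (Hq : (exp (- (b * rho)) < 1)%R).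
  { rewrite <- exp_0. apply exp_increasing. nra. }
  set (q := exp (- (b * rho))) in *. assert (Hq0 : (0 < q)%R) by apply exp_pos.
  assert (Hk : (0 < / (1 - q))%R) by (apply Rinv_0_lt_compat; lra).
  induction k as [|k IH]; intros M y Hy.
  - rewrite Nat.add_0_r. unfold Cminus. rewrite Cplus_opp_r, Cmod_0.
    pose proof (exp_pos (- (b * y))). apply Rmult_le_pos; auto. apply Rmult_le_pos; lra.
  - replace (M + S k)%nat with (S M + k)%nat by lia.
    replace (dirichlet_partial a (S M + k) s - dirichlet_partial a M s) with
      ((dirichlet_partial a (S M + k) s - dirichlet_partial a (S M) s) + a (S M) * npow (S M) (- s))
      by (rewrite (dirichlet_partial_S a M); ring).
    destruct (excluded_middle_informative (L (S M))) as [HL|HL].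
    + specialize (Hy (S M) ltac:(lia) HL) as HyM.
      assert (H1 : forall n, (S M < n)%nat -> L n -> (y + rho <= ln (INR n))%R).
      { intros n Hn HLn. specialize (Hsep (S M) n ltac:(lia) HL HLn Hn). lra. }
      specialize (IH (S M) _ H1). specialize (Hterm (S M) ltac:(lia)).
      eapply Rle_trans; [apply Cmod_triangle|].
      assert (H2 : (A * exp (- (b * ln (INR (S M)))) <= A * exp (- (b * y)))%R).
      { apply Rmult_le_compat_l; auto. apply exp_le. nra. }
      replace (- (b * (y + rho)))%R with (- (b * y) + - (b * rho))%R in IH by ring.
      rewrite exp_plus in IH. fold q in IH.
      assert (E : (A * (/ (1 - q) * exp (- (b * y))) = A * (/ (1 - q) * (exp (- (b * y)) * q)) + A * exp (- (b * y)))%R) by (field; lra).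
      lra.
    + rewrite (Hz (S M)) by (auto; lia). rewrite Cmult_0_l, Cplus_0_r. apply IH.
      intros n Hn HLn. apply Hy; auto. lia.
Qed.

(** A convergent Dirichlet series with support separated on the logarithmic
    scale converges absolutely, and uniformly on half-planes, as a power
    series does inside its disc of convergence. *)
Lemma lacunary_uniform a f (L : nat -> Prop) rho : dirichlet_cv a f -> (0 < rho)%R ->
  (forall n, (1 <= n)%nat -> ~ L n -> a n = 0) ->
  (forall n n', (1 <= n)%nat -> L n -> L n' -> (n < n')%nat -> (ln (INR n) + rho <= ln (INR n'))%R) ->
  forall eps del, (0 < eps)%R -> (0 < del)%R ->
  exists N, forall s, half_plane eps s -> (Cmod (f s - dirichlet_partial a N s) <= del)%R.
Proof.
  intros Ha Hr Hz Hsep eps del Heps Hdel. set (b := (eps / 2)%R). assert (Hb : (0 < b)%R) by (unfold b; lra).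
  destruct (dirichlet_coef_bound a f b Ha Hb) as [A [HA HB]].
  assert (Hq : (exp (- (b * rho)) < 1)%R).
  { rewrite <- exp_0. apply exp_increasing. nra. }
  set (kap := (/ (1 - exp (- (b * rho))))%R).
  assert (Hk : (0 < kap)%R) by (apply Rinv_0_lt_compat; lra).
  destruct (exp_decay b (A * kap) del Hb ltac:(apply Rmult_le_pos; lra) Hdel) as [B HD].
  destruct (nfloor_ex (exp B)) as [M [_ HM]]; [left; apply exp_pos|].
  assert (HM2 : forall n, (M < n)%nat -> (B <= ln (INR n))%R).
  { intros n Hn. rewrite <- (ln_exp B). apply ln_le; [apply exp_pos|].
    apply le_INR in Hn. rewrite S_INR in Hn. lra. }
  exists M. intros s Hs. unfold half_plane in Hs.
  apply (Clim_Cmod_le (fun k => dirichlet_partial a (M + k) s - dirichlet_partial a M s)).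
  - intros k. eapply Rle_trans; [apply (lacunary_block a L A b rho s Hb Hr HA Hz Hsep) with (y := B)|].
    + intros n Hn. rewrite Cmod_mult, Cmod_npow. pose proof (ln_INR_ge_0 n Hn) as Hl.
      apply Rle_trans with (A * exp (b * ln (INR n)) * exp (ln (INR n) * Re (- s)))%R.
      * apply Rmult_le_compat_r; [left; apply exp_pos|]. auto.
      * rewrite Rmult_assoc, <- exp_plus. apply Rmult_le_compat_l; auto. apply exp_le.
        destruct s; simpl in *. unfold b. nra.
    + intros n Hn _. auto.
    + fold kap. rewrite <- Rmult_assoc. apply HD. lra.
  - apply Clim_plus; [|apply Clim_const]. intros e He.
    destruct (proj1 (dirichlet_cv_Clim a f) Ha s ltac:(unfold half_plane; lra) e He) as [N0 HN].
    exists N0. intros k Hk0. apply HN. lia.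
Qed.

Lemma npow_Ci n tau : npow n (- (Ci * RtoC tau)) = cis (- (tau * ln (INR n))).
Proof.
  replace (- (Ci * RtoC tau)) with ((0, - tau)%R : C).
  - rewrite npow_cis, Rmult_0_r, exp_0. replace (ln (INR n) * - tau)%R with (- (tau * ln (INR n)))%R by ring. ring.
  - unfold Ci, RtoC, Cmult, Copp; simpl. f_equal; ring.
Qed.

Lemma cis_eq_iff x y : cis x = cis y <-> exists j : Z, (x - y = 2 * IZR j * PI)%R.
Proof.
  split.
  - intros E. unfold cis in E. injection E as E1 E2.
    assert (H : cos (x - y) = 1%R).
    { rewrite cos_minus, E1, E2. pose proof (sin2_cos2 y) as H. unfold Rsqr in H. lra. }
    assert (Hs : sin ((x - y) / 2) = 0%R).
    { replace (x - y)%R with (2 * ((x - y) / 2))%R in H by field. rewrite cos_2a_sin in H. nra. }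
    apply sin_eq_0_0 in Hs. destruct Hs as [j Hj]. exists j. lra.
  - intros [j Hj]. replace x with (2 * (IZR j * PI) + y)%R by lra.
    assert (Hs : sin (IZR j * PI) = 0%R) by (apply sin_eq_0_1; exists j; auto).
    unfold cis. rewrite cos_plus, sin_plus, cos_2a_sin, sin_2a, Hs. f_equal; ring.
Qed.

Lemma npow_Ci_eq_iff m n tau : npow n (- (Ci * RtoC tau)) = npow m (- (Ci * RtoC tau)) <->
  exists j : Z, (tau * (ln (INR n) - ln (INR m)) = 2 * IZR j * PI)%R.
Proof.
  rewrite !npow_Ci, cis_eq_iff. split; intros [j Hj]; exists (- j)%Z; rewrite opp_IZR; lra.
Qed.

(** Translation by i tau multiplies the n-th coefficient by n^(-i tau), and
    coefficients are unique. *)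
Lemma translation_eigen_coef phi tau a f lambda :
  eq_C0 phi (fun s => s + Ci * RtoC tau) -> dirichlet_cv a f ->
  (eq_C0 (comp_op phi f) (fun s => lambda * f s) <->
   forall n, (1 <= n)%nat -> a n <> 0 -> npow n (- (Ci * RtoC tau)) = lambda).
Proof.
  intros Hphi Ha.
  set (b := fun n => a n * npow n (- (Ci * RtoC tau)) + - lambda * a n).
  assert (Hb : dirichlet_cv b (fun s => f (phi s) + - lambda * f s)).
  { apply dirichlet_cv_plus with (f := fun s => f (phi s)); [|apply dirichlet_cv_scal; auto].
    apply dirichlet_cv_Clim. intros s Hs. rewrite (Hphi s Hs).
    assert (Hs' : half_plane 0 (s + Ci * RtoC tau)).
    { unfold half_plane in *. destruct s; simpl in *. lra. }
    apply Clim_ext with (2 := proj1 (dirichlet_cv_Clim a f) Ha _ Hs').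
    intros N. rewrite !dirichlet_csum. apply csum_ext. intros n _.
    replace (- (s + Ci * RtoC tau)) with (- (Ci * RtoC tau) + - s) by ring. rewrite npow_plus. ring. }
  split.
  - intros He n Hn Han.
    assert (Z : b n = 0).
    { apply (dirichlet_unique_zero _ _ Hb); auto. intros s Hs. specialize (He s Hs). unfold comp_op in He.
      rewrite He. ring. }
    unfold b in Z. set (w := npow n (- (Ci * RtoC tau))) in *.
    destruct (Ceq_dec (w - lambda) 0) as [E|E].
    + replace w with (w - lambda + lambda) by ring. rewrite E. ring.
    + exfalso. apply (Cmult_neq_0 _ _ Han E). rewrite <- Z. ring.
  - intros H s Hs. assert (E : f (phi s) + - lambda * f s = 0).
    { apply (dirichlet_cv_zero _ _ Hb); auto. intros n Hn. unfold b.
      destruct (Ceq_dec (a n) 0) as [->|Hn0]; [ring|]. rewrite (H n Hn Hn0). ring. }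
    unfold comp_op. replace (f (phi s)) with (f (phi s) + - lambda * f s + lambda * f s) by ring.
    rewrite E. ring.
Qed.

Lemma monomial_eigen phi tau m : (1 <= m)%nat -> eq_C0 phi (fun s => s + Ci * RtoC tau) ->
  eq_C0 (comp_op phi (monomial m)) (fun s => npow m (- (Ci * RtoC tau)) * monomial m s).
Proof.
  intros Hm Hphi s Hs. unfold comp_op. rewrite (Hphi s Hs). unfold monomial. rewrite <- npow_plus. f_equal. ring.
Qed.

Lemma seminorm_lt_bound eps f (del : R) : Rbar_lt (seminorm eps f) del ->
  forall s, half_plane eps s -> (Cmod (f s) <= del)%R.
Proof.
  intros H s Hs. pose proof (Lub_Rbar_correct (fun x : R => exists s : C, half_plane eps s /\ x = Cmod (f s))) as [Hub _].
  assert (Hle : Rbar_le (Cmod (f s)) (seminorm eps f)) by (apply Hub; exists s; auto).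
  left. exact (Rbar_le_lt_trans _ _ _ Hle H).
Qed.

Lemma seminorm_le eps f (M : R) : (forall s, half_plane eps s -> (Cmod (f s) <= M)%R) ->
  Rbar_le (seminorm eps f) M.
Proof.
  intros H. pose proof (Lub_Rbar_correct (fun x : R => exists s : C, half_plane eps s /\ x = Cmod (f s))) as [_ Hl].
  apply Hl. intros x [s [Hs ->]]. simpl. auto.
Qed.

Lemma list_positive_lower_bound (l : list R) : (forall e, In e l -> (0 < e)%R) ->
  exists e0, (0 < e0)%R /\ forall e, In e l -> (e0 <= e)%R.
Proof.
  induction l as [|x l IH]; intros H.
  - exists 1%R. split; [lra|]. intros e [].
  - destruct IH as [e0 [H0 He]]; [intros; apply H; right; auto|].
    exists (Rmin x e0). split; [apply Rmin_pos; auto; apply H; left; auto|].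
    intros e [->|Hin]; [apply Rmin_l|]. eapply Rle_trans; [apply Rmin_r|auto].
Qed.

(** The support of an eigenvector consists of n with tau (ln n - ln m) in 2 pi
    Z, so its logarithms are 2 pi / |tau| apart and the partial sums, which
    lie in the span, converge uniformly. Conversely the eigenvalue equation
    passes to uniform limits. *)
Lemma translation_closed_span phi tau m f (L : nat -> Prop) :
  tau <> 0%R -> eq_C0 phi (fun s => s + Ci * RtoC tau) -> (1 <= m)%nat ->
  (forall n, (1 <= n)%nat -> (L n <-> npow n (- (Ci * RtoC tau)) = npow m (- (Ci * RtoC tau)))) ->
  (eigenspace phi (npow m (- (Ci * RtoC tau))) f <->
   closed_span (fun g => exists n, (1 <= n)%nat /\ L n /\ g = monomial n) f).
Proof.
  intros Htau Hphi Hm HL. set (lambda := npow m (- (Ci * RtoC tau))) in *. split.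
  - intros [Hi He]. split; auto. intros l del Hl Hdel.
    destruct Hi as [_ [_ [a Ha]]].
    pose proof (proj1 (translation_eigen_coef phi tau a f lambda Hphi Ha) He) as Hsupp.
    destruct (list_positive_lower_bound l Hl) as [e0 [He0 Hle]].
    set (rho := (2 * PI / Rabs tau)%R).
    assert (Hat : (0 < Rabs tau)%R) by (apply Rabs_pos_lt; auto).
    pose proof PI_RGT_0 as HPI.
    assert (Hrho : (0 < rho)%R) by (apply Rdiv_lt_0_compat; lra).
    destruct (lacunary_uniform a f (fun n => (1 <= n)%nat /\ L n) rho Ha Hrho) with (eps := e0) (del := (del / 2)%R) as [N HN]; try lra.
    + intros n Hn HnL. destruct (Ceq_dec (a n) 0) as [|Hz]; auto. exfalso. apply HnL. split; auto.
      apply HL; auto.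
    + intros n n' Hn [_ Ln] [Hn' Ln'] Hnn.
      assert (E : npow n' (- (Ci * RtoC tau)) = npow n (- (Ci * RtoC tau))).
      { transitivity lambda; [|symmetry]; apply HL; auto. }
      apply npow_Ci_eq_iff in E. destruct E as [j Hj].
      pose proof (ln_INR_lt n n' Hn Hnn) as Hlt. set (d := (ln (INR n') - ln (INR n))%R) in *.
      assert (Hd : (0 < d)%R) by (unfold d; lra).
      assert (Hj0 : (1 <= Rabs (IZR j))%R).
      { rewrite <- abs_IZR. apply IZR_le. assert (j <> 0%Z); [|lia]. intros ->.
        assert (tau * d <> 0)%R by (apply Rmult_integral_contrapositive_currified; auto; lra). lra. }
      assert (Ht : (rho * Rabs tau = 2 * PI)%R) by (unfold rho; field; lra).
      apply (f_equal Rabs) in Hj. rewrite !Rabs_mult, (Rabs_right d), (Rabs_right 2), (Rabs_right PI) in Hj by lra.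
      assert (rho <= d)%R; [|unfold d in *; lra].
      apply Rmult_le_reg_r with (Rabs tau); auto. nra.
    + (* outside L the coefficient is 0, and the monomial of index m serves as a filler *)
      assert (HA : forall n, (1 <= n <= N)%nat -> exists n0, (1 <= n0)%nat /\ L n0 /\
        monomial (if excluded_middle_informative (L n) then n else m) = monomial n0).
      { intros n Hn. destruct (excluded_middle_informative (L n)) as [Ln|Ln].
        - exists n. repeat split; auto. lia.
        - exists m. repeat split; auto. apply HL; auto. }
      exists (dirichlet_partial a N). split; [|split].
      * exists N, a, (fun n => monomial (if excluded_middle_informative (L n) then n else m)). split; auto.
        intros s Hs. rewrite lin_comb_csum, dirichlet_csum. apply csum_ext. intros n Hn.
        destruct (excluded_middle_informative (L n)) as [Ln|Ln]; auto.
        destruct (Ceq_dec (a n) 0) as [->|Hz]; [ring|]. exfalso. apply Ln. apply HL; [lia|]. apply Hsupp; auto. lia.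
      * apply Hinf_ext with (lin_comb N a monomial); [intros s Hs; reflexivity|].
        apply Hinf_lin_comb. intros i Hi'. apply Hinf_monomial. lia.
      * intros eps Heps. apply Rbar_le_lt_trans with (Finite (del / 2)); [|simpl; lra].
        apply seminorm_le. intros s Hs. apply HN. specialize (Hle eps Heps). unfold half_plane in *. lra.
  - intros [Hi Hcl]. split; auto. intros s Hs. apply C_eq_of_small. intros eta Heta.
    unfold half_plane in Hs.
    destruct (Hcl (Re s / 2 :: nil)%R%list (eta / 2)%R) as [g [[N [b [e [HA Hg]]]] [_ Hsn]]].
    { intros eps [<-|[]]. lra. } { lra. }
    pose proof (seminorm_lt_bound _ _ _ (Hsn _ (or_introl eq_refl))) as Hfg. cbv beta in Hfg.
    assert (Hs' : half_plane 0 (phi s)).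
    { rewrite Hphi by exact Hs. unfold half_plane. destruct s; simpl in *. lra. }
    assert (Hge : g (phi s) = lambda * g s).
    { rewrite (Hg s Hs), (Hg _ Hs'), !lin_comb_csum, <- csum_scal. apply csum_ext. intros i Hi'.
      destruct (HA i Hi') as [n [Hn [Ln ->]]].
      pose proof (monomial_eigen phi tau n Hn Hphi s Hs) as E. unfold comp_op in E. rewrite E.
      rewrite (proj1 (HL n Hn) Ln). ring. }
    unfold comp_op.
    replace (f (phi s) - lambda * f s) with ((f (phi s) - g (phi s)) + - lambda * (f s - g s)) by (rewrite Hge; ring).
    eapply Rle_trans; [apply Cmod_triangle|]. rewrite Cmod_mult, Cmod_opp.
    assert (Hl1 : Cmod lambda = 1%R) by (unfold lambda; rewrite npow_Ci; apply Cmod_cis).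
    rewrite Hl1. 
    assert (Cmod (f s - g s) <= eta / 2)%R by (apply Hfg; unfold half_plane; lra).
    assert (Cmod (f (phi s) - g (phi s)) <= eta / 2)%R.
    { apply Hfg. rewrite Hphi by exact Hs. unfold half_plane. destruct s; simpl in *; lra. }
    lra.
Qed.

(** The exponent [l] corresponds to the multiple -2 pi l of the angle tau (ln
    n - ln m). *)
Lemma log_ratio_orbit tau k m0 n0 m n : log_ratio_form tau k m0 n0 -> (1 <= m)%nat -> (1 <= n)%nat ->
  ((exists l : Z, INR n = (INR m * Rpower (INR n0 / INR m0) (IZR l / IZR k))%R) <->
   npow n (- (Ci * RtoC tau)) = npow m (- (Ci * RtoC tau))).
Proof.
  intros [Hk [Hm0 [Hn0 [Hne Htau]]]] Hm Hn. rewrite npow_Ci_eq_iff.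
  assert (Pm0 : (0 < INR m0)%R) by (apply lt_0_INR; lia). assert (Pn0 : (0 < INR n0)%R) by (apply lt_0_INR; lia).
  assert (Pm : (0 < INR m)%R) by (apply lt_0_INR; lia). assert (Pn : (0 < INR n)%R) by (apply lt_0_INR; lia).
  assert (HkR : IZR k <> 0%R) by (apply eq_IZR_contrapositive; auto).
  rewrite ln_div in Htau by auto. set (q := (ln (INR m0) - ln (INR n0))%R) in *.
  assert (Hq : q <> 0%R).
  { unfold q. intros E. apply Hne. apply INR_eq, ln_inv; auto. lra. }
  pose proof PI_RGT_0 as HPI.
  assert (Hlog : forall l, INR n = (INR m * Rpower (INR n0 / INR m0) (IZR l / IZR k))%R <->
     (ln (INR n) - ln (INR m) = - (IZR l / IZR k) * q)%R).
  { intros l. unfold Rpower. rewrite ln_div by auto.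
    replace (IZR l / IZR k * (ln (INR n0) - ln (INR m0)))%R with (- (IZR l / IZR k) * q)%R by (unfold q; ring).
    split; intros E.
    - rewrite E, ln_mult, ln_exp by (auto; apply exp_pos). ring.
    - apply ln_inv; auto. apply Rmult_lt_0_compat; auto; apply exp_pos.
      rewrite ln_mult, ln_exp by (auto; apply exp_pos). lra. }
  split.
  - intros [l Hl]. apply Hlog in Hl. exists (- l)%Z. rewrite Hl, Htau, opp_IZR. field. auto.
  - intros [j Hj]. exists (- j)%Z. apply Hlog. rewrite opp_IZR.
    apply Rmult_eq_reg_l with tau.
    + rewrite Hj, Htau. field. auto.
    + rewrite Htau. apply Rmult_integral_contrapositive_currified; [|apply Rinv_neq_0_compat; auto].
      apply Rmult_integral_contrapositive_currified; [|lra].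
      apply Rmult_integral_contrapositive_currified; [lra|auto].
Qed.

(** If n^(-i tau) = m^(-i tau) with n <> m, then tau = 2 pi j / ln (n/m) for
    some integer j, nonzero as tau is; this is the excluded form. *)
Lemma translation_one_dim phi tau m f :
  eq_C0 phi (fun s => s + Ci * RtoC tau) -> (1 <= m)%nat -> tau <> 0%R ->
  ~ (exists (k : Z) (m0 n0 : nat), log_ratio_form tau k m0 n0) ->
  (eigenspace phi (npow m (- (Ci * RtoC tau))) f <-> exists k, eq_C0 f (fun s => k * monomial m s)).
Proof.
  intros Hphi Hm Htau Hnot. split.
  - intros [[_ [_ [a Ha]]] He].
    pose proof (proj1 (translation_eigen_coef phi tau a f _ Hphi Ha) He) as Hsupp.
    assert (Hz : forall n, (1 <= n)%nat -> n <> m -> a n = 0).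
    { intros n Hn Hnm. destruct (Ceq_dec (a n) 0) as [|Hz]; auto. exfalso. apply Hnot.
      specialize (Hsupp n Hn Hz). apply npow_Ci_eq_iff in Hsupp. destruct Hsupp as [j Hj].
      assert (Hq : (ln (INR n) - ln (INR m) <> 0)%R).
      { intros E. apply Hnm, INR_eq, ln_inv; try (apply lt_0_INR; lia). lra. }
      exists j, n, m. split; [|repeat split; auto].
      - intros ->. apply (Rmult_integral_contrapositive_currified _ _ Htau Hq). lra.
      - rewrite ln_div by (apply lt_0_INR; lia).
        apply Rmult_eq_reg_r with (ln (INR n) - ln (INR m))%R; auto. rewrite Hj. field. auto. }
    exists (a m). pose proof (dirichlet_cv_minus_monomial a f (a m) m Hm Ha) as Hd.
    intros s Hs. assert (E : f s + - a m * monomial m s = 0).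
    { apply (dirichlet_cv_zero _ _ Hd); auto. intros n Hn. unfold unit_coef.
      destruct (Nat.eqb_spec n m) as [->|Hnm]; [ring|]. rewrite Hz by auto. ring. }
    replace (f s) with (f s + - a m * monomial m s + a m * monomial m s) by ring. rewrite E. ring.
  - intros [k Hk]. split.
    + apply Hinf_ext with (fun s => k * monomial m s); [intros s Hs; symmetry; auto|].
      apply Hinf_scal, Hinf_monomial; auto.
    + intros s Hs. pose proof (monomial_eigen phi tau m Hm Hphi s Hs) as E. unfold comp_op in *.
      rewrite (Hk s Hs), (Hk (phi s)), E; [ring|]. rewrite Hphi by auto.
      unfold half_plane in *. destruct s; simpl in *; lra.
Qed.

Theorem theorem3p1 (c0 : nat) (c : nat -> C) (phi u : C -> C)
  (Hphi : G_pos c0 c phi) (Hu : koenigs_map c0 c phi u) :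
  (* (i) *)
  ((1 < c0)%nat ->
    (forall lambda : C, point_spectrum phi lambda <-> lambda = RtoC 1) /\
    (forall f : C -> C, Hinf_plus f ->
       (eq_C0 (comp_op phi f) f <-> exists a : C, eq_C0 f (fun _ => a))))
  /\
  (* (ii) *)
  (c0 = 1%nat ->
   ~ (exists tau : R, eq_C0 phi (fun s => s + Ci * RtoC tau)) ->
    (forall lambda : C, point_spectrum phi lambda <->
       exists m : nat, (1 <= m)%nat /\ lambda = npow m (- c 1%nat)) /\
    (forall m : nat, (1 <= m)%nat ->
       has_dimension (eigenspace phi (npow m (- c 1%nat))) 1 /\
       (forall f : C -> C, eigenspace phi (npow m (- c 1%nat)) f <->
          span (fun g => g = (fun s => npow m (- u s))) f)))
  /\
  (* (iii) *)
  (forall tau : R, tau <> 0%R ->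
   eq_C0 phi (fun s => s + Ci * RtoC tau) ->
    (forall lambda : C, point_spectrum phi lambda <->
       exists m : nat, (1 <= m)%nat /\ lambda = npow m (- (Ci * RtoC tau))) /\
    (* (a) *)
    (forall (k : Z) (m0 n0 : nat), log_ratio_form tau k m0 n0 ->
     forall m : nat, (1 <= m)%nat ->
     forall f : C -> C,
       eigenspace phi (npow m (- (Ci * RtoC tau))) f <->
       closed_span
         (fun g => exists n : nat, (1 <= n)%nat /\
            (exists l : Z,
               INR n = (INR m * Rpower (INR n0 / INR m0) (IZR l / IZR k))%R) /\
            g = (fun s => npow n (- s))) f) /\
    (* (b) *)
    (~ (exists (k : Z) (m0 n0 : nat), log_ratio_form tau k m0 n0) ->
     forall m : nat, (1 <= m)%nat ->
       has_dimension (eigenspace phi (npow m (- (Ci * RtoC tau)))) 1 /\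
       (forall f : C -> C,
          eigenspace phi (npow m (- (Ci * RtoC tau))) f <->
          span (fun g => g = (fun s => npow m (- s))) f))).
Proof.
  split; [|split].
  - intros Hc. apply (characteristic_gt_one_case c0 c phi Hphi Hc).
  - intros -> Hnt. apply (characteristic_one_case c phi u Hphi Hu Hnt).
  - intros tau Htau Htr. split; [|split].
    + intros lambda. split.
      * intros [f [[[_ [_ [a Ha]]] He] Hn]]. destruct (leading_index a f Ha Hn) as [m [Hm [Ham _]]].
        exists m. split; auto. symmetry. eapply translation_eigen_coef; eauto.
      * intros [m [Hm ->]]. exists (monomial m). split; [split|].
        -- apply Hinf_monomial; auto.
        -- apply monomial_eigen; auto.
        -- intros E. apply (npow_neq_0 m (- RtoC 1)). apply (E _ one_C0).
    + intros k m0 n0 Hform m Hm f.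
      apply (translation_closed_span phi tau m f
        (fun n => exists l : Z, INR n = (INR m * Rpower (INR n0 / INR m0) (IZR l / IZR k))%R)); auto.
      intros n Hn. apply log_ratio_orbit; auto.
    + intros Hnot m Hm. split.
      * apply has_dimension_single with (monomial m).
        -- exists (RtoC 1). split; [apply one_C0|apply npow_neq_0].
        -- intros f. apply translation_one_dim; auto.
      * intros f. rewrite span_single. apply translation_one_dim; auto.
Qed.
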